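(* Let $\lambda\ge0$, $p_0=\frac{2\lambda}{2\lambda+1}$, $p_0\le p_1\le1\le p_2<\infty$ (with $p_1>0$) and $\alpha>0$. If $g$ is a $\lambda$-analytic function on $\mathbb{D}$ such that $d\mu_g(z):=|g(z)|^{p_2}d\sigma_\lambda(z)$ is a $(\lambda p_2/p_1,(\alpha+1)p_2/p_1)$-Carleson measure, then the multiplication operator $T_g$, $T_gf(z)=g(z)f(z)$, is bounded from $A^{p_1}_{\lambda,\alpha}(\mathbb{D})$ into $L^{p_2}_\lambda(\mathbb{D})$.
   Context: $\mathbb{D}$ is the open unit disk in $\mathbb{C}$. For $\lambda\ge0$ the Dunkl operator $D_{\bar z}$ is $D_{\bar z}f(z)=\partial_{\bar z}f-\lambda\frac{f(z)-f(\bar z)}{z-\bar z}$ (the quotient being understood as its limit on the real axis). A $C^2$ function $f$ on $\mathbb{D}$ is $\lambda$-analytic if $D_{\bar z}f=0$. Let $d\sigma_\lambda(z)=c_\lambda|y|^{2\lambda}\,dx\,dy$ ($z=x+iy$), $c_\lambda=\Gamma(\lambda+2)/(\Gamma(\lambda+1/2)\Gamma(1/2))$. For $0<p<\infty$, $L^p_\lambda(\mathbb{D})$ is the space of measurable functions $f$ on $\mathbb{D}$ with $\|f\|_{L^p_\lambda(\mathbb{D})}=\left(\int_{\mathbb{D}}|f|^pd\sigma_\lambda\right)^{1/p}<\infty$. For $\alpha>0$, $A^p_{\lambda,\alpha}(\mathbb{D})$ is the set of $\lambda$-analytic functions $f$ on $\mathbb{D}$ with $\|f\|_{A^p_{\lambda,\alpha}}=\left(\int_{\mathbb{D}}|f(z)|^p(1-|z|)^{\alpha-1}d\sigma_\lambda(z)\right)^{1/p}<\infty$.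 Boundedness of $T_g$ means $\|T_gf\|_{L^{p_2}_\lambda(\mathbb{D})}\le C\|f\|_{A^{p_1}_{\lambda,\alpha}}$ for all $f\in A^{p_1}_{\lambda,\alpha}(\mathbb{D})$. For $\theta\in[0,2\pi)$ and $0<h<1$ let $S_\theta(h)=\{z\in\mathbb{D}:|z-e^{i\theta}|\le2h\}$. For $\lambda'\ge0$ and $\alpha'>0$, a finite Borel measure $\mu$ on $\mathbb{D}$ is a $(\lambda',\alpha')$-Carleson measure if $\mu(S_\theta(h))=O\left((h+|\sin\theta|)^{2\lambda'}h^{\alpha'}\right)$, uniformly for $0\le\theta<2\pi$, $0<h<1$. *)

(* Defs.v *)
From HB Require Import structures.
From mathcomp Require Import all_boot all_order all_algebra.
From mathcomp Require Import complex.
From mathcomp Require Import all_classical all_reals all_analysis.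
From mathcomp Require Import measurable_realfun.

Set Implicit Arguments.
Unset Strict Implicit.
Unset Printing Implicit Defensive.

Import Order.TTheory GRing.Theory Num.Theory.
Import numFieldNormedType.Exports.

Local Open Scope classical_set_scope.
Local Open Scope ring_scope.
Local Open Scope complex_scope.

(* Functions on the unit disk are total functions [R[i] -> R[i]] of which only
   the values on [disk R] matter. Measure theory and partial derivatives live on
   [R * R], which is identified with [R[i]] through [cplx]. The norm of [R[i]]
   takes its values in [R[i]]; [cabs] is the real-valued modulus. *)

(* The Borel sigma-algebra used by [lebesgue_measure]. *)
Notation plane R := (measurableTypeR R * measurableTypeR R)%type.

Definition cplx (R : realType) (z : R * R) : R[i] := z.1 +i* z.2.

Definition cabs (R : realType) (w : R[i]) : R := complex.Re `|w|.

Definition disk (R : realType) : set R[i] := [set w | cabs w < 1].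
Arguments disk : clear implicits.

Definition pdisk (R : realType) : set (R * R) := @cplx R @^-1` disk R.
Arguments pdisk : clear implicits.

Definition is_C1_on (R : realType) (U : set (R * R)) (u : R * R -> R) : Prop :=
  forall z, U z -> forall v : R * R, v = (1, 0) \/ v = (0, 1) ->
    derivable u z v /\ {for z, continuous ('D_v u)}.

Definition is_C2_on (R : realType) (U : set (R * R)) (u : R * R -> R) : Prop :=
  [/\ is_C1_on U u, is_C1_on U ('D_((1, 0) : R * R) u) &
      is_C1_on U ('D_((0, 1) : R * R) u)].

Definition re_part (R : realType) (f : R[i] -> R[i]) (z : R * R) : R :=
  complex.Re (f (cplx z)).

Definition im_part (R : realType) (f : R[i] -> R[i]) (z : R * R) : R :=
  complex.Im (f (cplx z)).

Definition pderiv (R : realType) (v : R * R) (f : R[i] -> R[i]) (w : R[i]) :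
    R[i] :=
  'D_v (re_part f) (complex.Re w, complex.Im w) +i* 'D_v (im_part f) (complex.Re w, complex.Im w).

Definition dbar (R : realType) (f : R[i] -> R[i]) (w : R[i]) : R[i] :=
  (pderiv (1, 0) f w + (0 +i* 1) * pderiv (0, 1) f w) / 2%:R.

Definition conj_quot (R : realType) (f : R[i] -> R[i]) (w : R[i]) : R[i] :=
  (f w - f (conjc w)) / (w - conjc w).

Definition dunkl_quot (R : realType) (f : R[i] -> R[i]) (w : R[i]) : R[i] :=
  if complex.Im w == 0 then
    lim ((conj_quot f t : R[i]^o)
           @[t --> within [set t | complex.Im t != 0] (nbhs (w : R[i]^o))])
  else conj_quot f w.

Definition dunkl_dbar (R : realType) (l : R) (f : R[i] -> R[i]) (w : R[i]) :
    R[i] :=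
  dbar f w - l%:C * dunkl_quot f w.

Definition lambda_analytic (R : realType) (l : R) (f : R[i] -> R[i]) : Prop :=
  [/\ is_C2_on (pdisk R) (re_part f), is_C2_on (pdisk R) (im_part f) &
      forall w, disk R w -> dunkl_dbar l f w = 0].

Definition Gamma (R : realType) (s : R) : R :=
  \int[@lebesgue_measure R]_(t in `]0, +oo[) (t `^ (s - 1) * expR (- t)).

Definition c_lambda (R : realType) (l : R) : R :=
  Gamma (l + 2) / (Gamma (l + 2^-1) * Gamma 2^-1).

Definition sigma_density (R : realType) (l : R) (z : R * R) : \bar R :=
  (c_lambda l * `|z.2| `^ (2 * l))%:E.

Definition sigma (R : realType) (l : R) (A : set (plane R)) : \bar R :=
  (\int[@lebesgue_measure R \x @lebesgue_measure R]_(z in A)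
     sigma_density l z)%E.

Section sigma_measure.
Variables (R : realType) (l : R).

Let Gamma_ge0 (s : R) : 0 <= Gamma s.
Proof.
apply: Rintegral_ge0 => t _.
by rewrite mulr_ge0 ?powR_ge0 ?expR_ge0.
Qed.

Let sigma_density_ge0 z : (0 <= sigma_density l z)%E.
Proof.
by rewrite lee_fin mulr_ge0 ?powR_ge0// divr_ge0 ?mulr_ge0 ?Gamma_ge0.
Qed.

Let measurable_sigma_density :
  measurable_fun (setT : set (plane R)) (sigma_density l).
Proof.
apply/measurable_EFinP; apply: measurable_funM => //.
apply: (measurableT_comp (measurable_powR _)).
exact: (measurableT_comp (@normr_measurable R setT) measurable_snd).
Qed.

Let sigma0 : sigma l set0 = 0%E.
Proof. exact: integral_set0. Qed.

Let sigma_ge0 A : (0 <= sigma l A)%E.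
Proof. exact: integral_ge0. Qed.

Let sigma_sigma_additive : semi_sigma_additive (sigma l).
Proof. exact: semi_sigma_additive_nng_induced. Qed.

HB.instance Definition _ := isMeasure.Build _ _ _ (sigma l)
  sigma0 sigma_ge0 sigma_sigma_additive.

End sigma_measure.

Definition disk_measurable_fun (R : realType) (f : R[i] -> R[i]) : Prop :=
  measurable_fun (pdisk R : set (plane R)) (re_part f) /\
  measurable_fun (pdisk R : set (plane R)) (im_part f).

Definition Lp_norm (R : realType) (l p : R) (f : R[i] -> R[i]) : \bar R :=
  ((\int[sigma l]_(z in pdisk R) (cabs (f (cplx z)) `^ p)%:E) `^ p^-1)%E.

Definition in_Lp (R : realType) (l p : R) (f : R[i] -> R[i]) : Prop :=
  disk_measurable_fun f /\ (Lp_norm l p f < +oo)%E.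

Definition bergman_norm (R : realType) (l a p : R) (f : R[i] -> R[i]) :
    \bar R :=
  ((\int[sigma l]_(z in pdisk R)
     (cabs (f (cplx z)) `^ p * (1 - cabs (cplx z)) `^ (a - 1))%:E)
   `^ p^-1)%E.

Definition in_bergman (R : realType) (l a p : R) (f : R[i] -> R[i]) : Prop :=
  lambda_analytic l f /\ (bergman_norm l a p f < +oo)%E.

Definition mult_op (R : realType) (g f : R[i] -> R[i]) : R[i] -> R[i] :=
  fun w => g w * f w.

Definition mult_op_bounded (R : realType) (l a p1 p2 : R) (g : R[i] -> R[i]) :
    Prop :=
  exists C : R, forall f, in_bergman l a p1 f ->
    in_Lp l p2 (mult_op g f) /\
    (Lp_norm l p2 (mult_op g f) <= C%:E * bergman_norm l a p1 f)%E.

Definition carleson_box (R : realType) (theta h : R) : set (R * R) :=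
  [set z | pdisk R z /\ cabs (cplx z - (cos theta +i* sin theta)) <= 2 * h].

(* A set function is a finite Borel measure on the disk when it agrees, on the
   Borel subsets of the disk, with a finite Borel measure on [R * R]. *)
Definition disk_finite_measure (R : realType) (mu : set (plane R) -> \bar R) :
    Prop :=
  exists m : {finite_measure set (plane R) -> \bar R},
    forall A, measurable A -> A `<=` pdisk R -> mu A = m A.

Definition carleson_measure (R : realType) (l a : R)
    (mu : set (plane R) -> \bar R) : Prop :=
  disk_finite_measure mu /\
  exists C : R, forall theta h : R, 0 <= theta < 2 * pi -> 0 < h < 1 ->
    (mu (carleson_box theta h) <=
       (C * ((h + `|sin theta|) `^ (2 * l) * h `^ a))%:E)%E.

Definition mu_g (R : realType) (l p : R) (g : R[i] -> R[i])
    (A : set (plane R)) : \bar R :=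
  (\int[sigma l]_(z in A) (cabs (g (cplx z)) `^ p)%:E)%E.

(* Main.v *)
Require Import Defs.
From HB Require Import structures.
From mathcomp Require Import all_boot all_order all_algebra.
From mathcomp Require Import complex.
From mathcomp Require Import all_classical all_reals all_analysis.
From mathcomp Require Import measurable_realfun.
From mathcomp Require Import ring lra.

(* Write f = f_e + f_o for the parts of f that are even and odd under
   conjugation. The Dunkl equation becomes, for the real pairs
   (U, V) = (Re f_e, Im f_o) and (Im f_e, - Re f_o), the generalized
   Cauchy-Riemann system U_x = V_y + 2 lambda V / y, U_y = - V_x. A barrier
   argument for u(x + t, y) - u(x - t, y) bounds the gradient of (U, V) at the
   centre of a box by its supremum over the box divided by the size of the box.
   Maximizing a power of the distance to the boundary times |U| + |V| then
   yields a sub-mean-value inequality for (|U| + |V|)^p, for every p > 0, and so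
   |f(z)|^p1 is at most a constant times the sigma_lambda-average of
   |f(w)|^p1 + |f(wbar)|^p1 over a Whitney box around z. Raising this to the
   power p2 / p1 >= 1, integrating against mu_g and exchanging the integrals
   leaves the mu_g-measure of the set of the z whose Whitney box contains w, and
   this set is covered by two Carleson boxes of height comparable to 1 - |w|. *)

Set Implicit Arguments.
Unset Strict Implicit.
Unset Printing Implicit Defensive.

Import Order.TTheory GRing.Theory Num.Theory.
Import numFieldNormedType.Exports.

Local Open Scope classical_set_scope.
Local Open Scope ring_scope.

(** * Differential calculus *)

(** The coefficient 2 lambda / y is singular on the real axis, so interior elliptic estimates would
    degenerate as a box approaches it. The barrier is uniform up to the axis because parity provides
    V = 0 and U_y = 0 there, which excludes maxima on that face. It controls only x-derivatives,
    since translation in x preserves the equations and translation in y does not; the system itself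
    then returns the y-derivatives.

    Two scalings have to match at the end. The mass of the Whitney box of z under (1 - |w|)^(alpha -
    1) dsigma_lambda(w) is of order W(z) = (1 - |z|)^(alpha + 1) (1 - |z| + |y|)^(2 lambda), and
    |f(z)|^p1 W(z) is bounded by a local integral j(z). With q = p2 / p1, the Carleson exponents are
    exactly those that bound the mu_g-measure attached to w by a multiple of W(w)^q, which cancels
    the W(z)^(-q) left by the power q. The inequality j^q <= j b^(q - 1), with b the integral over
    the whole disk, makes the integrand linear in j before the exchange of integrals and produces
    the homogeneity b^q. *)

Section one_variable.
Context {R : realType}.
Implicit Types (h dh f df : R -> R) (a b c d e k x : R).

Lemma exists_lt2 a b : 0 < a -> 0 < b -> exists t, [/\ 0 < t, t < a & t < b].
Proof.
move=> a0 b0; exists (Num.min a b / 2); have [ab|ba] := leP a b; split; lra.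
Qed.

Lemma is_derive_gt0_near h c d : is_derive c 1 h d -> 0 < d ->
  exists2 e, 0 < e & forall t, 0 < t < e -> h c < h (c + t) /\ h (c - t) < h c.
Proof.
move=> [/= dh hd] d0.
have /cvgrPdist_lt /(_ _ d0) : s^-1 *: (h (s *: 1 + c) - h c) @[s --> 0^'] --> d.
  by rewrite -hd; exact: dh.
move=> [e /= e0 He]; exists e => // t /andP[t0 te].
have H s : `|s| < e -> s != 0 -> 0 < s^-1 * (h (s + c) - h c).
  move=> se s0; have /= := He s; rewrite sub0r normrN => /(_ se s0).
  rewrite [s *: 1]mulr1 -[_ *: _]/(_ * _) ltr_norml => /andP[_].
  by rewrite ltrBlDr ltrDl.
split.
  have := H t; rewrite gtr0_norm// gt_eqF// => /(_ te isT).
  by rewrite pmulr_rgt0 ?invr_gt0// subr_gt0 addrC.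
have := H (- t); rewrite normrN gtr0_norm// oppr_eq0 gt_eqF// => /(_ te isT).
by rewrite nmulr_rgt0 ?invr_lt0 ?oppr_lt0// subr_lt0 addrC.
Qed.

Lemma is_derive_left_max h c d e : 0 < e -> is_derive c 1 h d ->
  (forall t, 0 < t < e -> h (c + t) <= h c) -> d <= 0.
Proof.
move=> e0 hd hmax; rewrite leNgt; apply/negP => d0.
have [e' e'0 H] := is_derive_gt0_near hd d0.
have [t [t0 te te']] := exists_lt2 e0 e'0.
have [|+ _] := H t; first by rewrite t0.
by rewrite ltNge hmax// t0.
Qed.

Lemma is_derive_right_max h c d e : 0 < e -> is_derive c 1 h d ->
  (forall t, 0 < t < e -> h (c - t) <= h c) -> 0 <= d.
Proof.
move=> e0 hd hmax; rewrite leNgt; apply/negP => d0.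
have hdN : is_derive c 1 (- h) (- d) by apply: is_deriveN.
have [|e' e'0 H] := is_derive_gt0_near hdN; first by rewrite oppr_gt0.
have [t [t0 te te']] := exists_lt2 e0 e'0.
have [|_] := H t; first by rewrite t0.
by rewrite /GRing.opp/= ltrN2 ltNge hmax// t0.
Qed.

Lemma continuous_is_derive f c d : is_derive c 1 f d -> {for c, continuous f}.
Proof. by move=> [fd _]; apply/differentiable_continuous/derivable1_diffP. Qed.

Lemma MVT_is_derive f df a b : a < b ->
  (forall x, a <= x <= b -> is_derive x 1 f (df x)) ->
  exists2 c, a < c < b & f b - f a = df c * (b - a).
Proof.
move=> ab H.
have [||c] := @MVT _ f df a b ab.
- by move=> x; rewrite in_itv/= => /andP[ax xb]; apply: H; rewrite !ltW.
- apply/continuous_in_subspaceT => x; rewrite inE/= in_itv/= => /H.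
  exact: continuous_is_derive.
by rewrite in_itv/= => cab fab; exists c.
Qed.

(** Since [dh c = 0], a positive [d] would make [dh] positive just to the right of [c], and the mean
    value theorem would give a value of [h] above the maximum. *)
Lemma second_derive_max h dh c d e : 0 < e ->
  (forall x, `|x - c| < e -> is_derive x 1 h (dh x)) -> is_derive c 1 dh d ->
  (forall x, `|x - c| < e -> h x <= h c) -> dh c = 0 /\ d <= 0.
Proof.
move=> e0 hd hd2 hmax.
have cc : is_derive c 1 h (dh c) by apply: hd; rewrite subrr normr0.
have dhc0 : dh c = 0.
  apply/eqP; rewrite eq_le; apply/andP; split.
    apply: (is_derive_left_max e0 cc) => t /andP[t0 te].
    by apply: hmax; rewrite addrC addKr gtr0_norm.
  apply: (is_derive_right_max e0 cc) => t /andP[t0 te].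
  by apply: hmax; rewrite addrC addKr normrN gtr0_norm.
split=> //; rewrite leNgt; apply/negP => d0.
have [e' e'0 H] := is_derive_gt0_near hd2 d0.
have [t [t0 te te']] := exists_lt2 e0 e'0.
have [|x /andP[x1 x2]|y] := @MVT_is_derive h dh c (c + t); first by rewrite ltrDl.
  apply: hd; rewrite ger0_norm ?subr_ge0//.
  by rewrite ltrBlDl (le_lt_trans x2)// ltrD2l.
move=> /andP[cy yt] E.
have dy : 0 < dh y.
  rewrite -dhc0; have [|+ _] := H (y - c).
    by rewrite subr_gt0 cy/= ltrBlDl (lt_trans yt)// ltrD2l.
  by rewrite addrC subrK.
have : 0 < h (c + t) - h c by rewrite E mulr_gt0// addrC addKr.
by rewrite subr_gt0 ltNge hmax// addrC addKr gtr0_norm.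
Qed.

(** The bound on [df] is asked only inside the interval, so that a segment may end on the axis
    [y = 0], where the gradient estimates do not reach. *)
Lemma lipschitz_is_derive f df k a b :
  (forall x, Num.min a b <= x <= Num.max a b -> is_derive x 1 f (df x)) ->
  (forall x, Num.min a b < x < Num.max a b -> `|df x| <= k) ->
  `|f b - f a| <= k * `|b - a|.
Proof.
wlog ab : a b / a <= b.
  move=> H Hd Hk; have [ab|/ltW ba] := leP a b; first exact: H.
  by rewrite distrC [`|b - a|]distrC; apply: H => // x; rewrite minC maxC => ?; [exact: Hd|exact: Hk].
rewrite (min_idPl ab) (max_idPr ab) => Hd Hk.
move: ab; rewrite le_eqVlt => /predU1P[->|ab]; first by rewrite !subrr normr0 mulr0.
have [c cab ->] := @MVT_is_derive f df a b ab Hd.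
by rewrite normrM ler_wpM2r// Hk.
Qed.

End one_variable.

Section planar_calculus.
Context {R : realType}.
Implicit Types (u : R * R -> R) (e d : R) (D : set (R * R)) (z : R * R).

Local Notation ex := ((1, 0) : R * R).
Local Notation ey := ((0, 1) : R * R).

Lemma is_derive_ex u x y : derivable u (x, y) ex ->
  is_derive x 1 (fun s => u (s, y)) ('D_ex u (x, y)).
Proof.
have E : (fun h : R => h^-1 *: (u (h *: ex + (x, y)) - u (x, y))) =
    (fun h : R => h^-1 *: (u (h *: 1 + x, y) - u (x, y))).
  apply/funext => h; congr (_ *: (u _ - _)).
  by rewrite /GRing.scale/= /scale_pair /GRing.add/= /add_pair/= scaler0 add0r.
move=> du; apply: DeriveDef; first by move: du; rewrite /derivable E.
by rewrite /derive E.
Qed.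

Lemma is_derive_ey u x y : derivable u (x, y) ey ->
  is_derive y 1 (fun s => u (x, s)) ('D_ey u (x, y)).
Proof.
have E : (fun h : R => h^-1 *: (u (h *: ey + (x, y)) - u (x, y))) =
    (fun h : R => h^-1 *: (u (x, h *: 1 + y) - u (x, y))).
  apply/funext => h; congr (_ *: (u _ - _)).
  by rewrite /GRing.scale/= /scale_pair /GRing.add/= /add_pair/= scaler0 add0r.
move=> du; apply: DeriveDef; first by move: du; rewrite /derivable E.
by rewrite /derive E.
Qed.

Lemma norm_le_near (a b k : R) : `|a - b| <= k -> `|a| <= `|b| + k.
Proof.
by move=> abk; rewrite -[a](subrK b) addrC (le_trans (ler_normD _ _))// lerD2l.
Qed.

Lemma open_box D z : open D -> D z -> exists2 e : R, 0 < e &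
  forall x y : R, `|x - z.1| < e -> `|y - z.2| < e -> D (x, y).
Proof.
move=> oD Dz; have /nbhs_ballP[e /= e0 De] := open_nbhs_nbhs (conj oD Dz).
exists e => // x y xz yz; apply: De; split=> /=; rewrite -ball_normE /ball_/=;
 by rewrite distrC.
Qed.

Lemma continuous_box u z e : {for z, continuous u} -> 0 < e ->
  exists2 d : R, 0 < d & forall x y : R, `|x - z.1| < d -> `|y - z.2| < d ->
   `|u (x, y) - u z| < e.
Proof.
move=> /cvgrPdist_lt + e0 => /(_ e e0) H.
have /nbhs_ballP[d /= d0 Hd] : nbhs z [set t | `|u z - u t| < e] := H.
exists d => // x y xz yz; rewrite distrC; apply: Hd; split=> /=;
 by rewrite -ball_normE /ball_/= distrC.
Qed.

Lemma box_continuous u z : (forall e : R, 0 < e ->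
  exists2 d : R, 0 < d & forall x y : R, `|x - z.1| < d -> `|y - z.2| < d ->
   `|u (x, y) - u z| < e) -> {for z, continuous u}.
Proof.
move=> H; apply/cvgrPdist_lt => e /H [d d0 Hd].
suff : nbhs z [set t | `|u z - u t| < e] by [].
apply/nbhs_ballP; exists d => //= -[x y] [/=].
by rewrite -!ball_normE /ball_/= => xz yz; rewrite distrC Hd// distrC.
Qed.

(** Existence of partial derivatives alone does not give continuity. Here the partials are
    continuous, hence bounded by [K] near [z], and the mean value theorem along one vertical and one
    horizontal segment makes [u] continuous at [z]. *)
Lemma is_C1_on_continuous D u z : open D -> is_C1_on D u -> D z ->
  {for z, continuous u}.
Proof.
case: z => x0 y0 oD C1 Dz.
have [d0 d00 HD] := open_box oD Dz.
have [_ cx] := C1 _ Dz ex (or_introl erefl).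
have [_ cy] := C1 _ Dz ey (or_intror erefl).
have [d1 d10 H1] := continuous_box cx ltr01.
have [d2 d20 H2] := continuous_box cy ltr01.
set K := `|'D_ex u (x0, y0)| + `|'D_ey u (x0, y0)| + 1.
have K0 : 0 < K by rewrite /K ltr_wpDl// addr_ge0.
apply: box_continuous => e e0 /=.
have eK : 0 < e / (2 * K) by rewrite divr_gt0// mulr_gt0.
have d12 : 0 < Num.min d1 d2 by rewrite lt_min d10.
have [t [t0 td0]] := exists_lt2 d00 d12.
rewrite lt_min => /andP[td1 td2].
have [s [s0 st se]] := exists_lt2 t0 eK.
exists s => // x y xs ys.
have near_ v w w0 : `|w - w0| < s -> Num.min w0 w <= v <= Num.max w0 w ->
    `|v - w0| < s.
  move=> + /andP[]; rewrite ge_min le_max !ltr_norml; clear; lra.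
have Hx : `|u (x, y) - u (x0, y)| <= K * `|x - x0|.
  apply: (@lipschitz_is_derive _ (fun v => u (v, y)) (fun v => 'D_ex u (v, y))).
    move=> v /(near_ _ _ _ xs) vs; apply: is_derive_ex.
    by apply: (proj1 (C1 _ _ ex (or_introl erefl))); apply: HD;
      [apply: lt_trans vs _|apply: lt_trans ys _]; exact: lt_trans td0.
  move=> v /andP[v1 v2].
  have vs : `|v - x0| < s by apply: (near_ _ _ _ xs); rewrite !ltW.
  apply: le_trans (norm_le_near (ltW (H1 v y _ _))) _ => /=.
  - by apply: lt_trans td1; exact: lt_trans st.
  - by apply: lt_trans td1; exact: lt_trans st.
  - by rewrite /K -addrA addrCA addrC lerDl.
have Hy : `|u (x0, y) - u (x0, y0)| <= K * `|y - y0|.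
  have x00 : `|x0 - x0| < s by rewrite subrr normr0.
  apply: (@lipschitz_is_derive _ (fun v => u (x0, v)) (fun v => 'D_ey u (x0, v))).
    move=> v /(near_ _ _ _ ys) vs; apply: is_derive_ey.
    by apply: (proj1 (C1 _ _ ey (or_intror erefl))); apply: HD;
      [apply: lt_trans x00 _|apply: lt_trans vs _]; exact: lt_trans td0.
  move=> v /andP[v1 v2].
  have vs : `|v - y0| < s by apply: (near_ _ _ _ ys); rewrite !ltW.
  apply: le_trans (norm_le_near (ltW (H2 x0 v _ _))) _ => /=.
  - by apply: lt_trans td2; exact: lt_trans st.
  - by apply: lt_trans td2; exact: lt_trans st.
  - by rewrite /K -addrA lerDr.
have -> : u (x, y) - u (x0, y0) = (u (x, y) - u (x0, y)) + (u (x0, y) - u (x0, y0)) by ring.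
apply: (le_lt_trans (ler_normD _ _)).
apply: (le_lt_trans (lerD Hx Hy)); rewrite -mulrDr.
have -> : e = K * (2 * (e / (2 * K))) by field; rewrite gt_eqF.
rewrite ltr_pM2l// mulr2n mulrDl mul1r ltrD//; exact: lt_trans se.
Qed.

(** Clairaut's theorem: the second difference of [u] over a square of side [h] is [h ^ 2] times a
    value of [uxy] and also [h ^ 2] times a value of [uyx], and both values tend to those at the
    corner. *)
Lemma mixed_derive (u ux uy uxy uyx : R -> R -> R) (x0 y0 d0 : R) : 0 < d0 ->
  (forall x y, `|x - x0| < d0 -> `|y - y0| < d0 ->
    [/\ is_derive x 1 (u ^~ y) (ux x y), is_derive y 1 (u x) (uy x y),
       is_derive y 1 (ux x) (uxy x y) & is_derive x 1 (uy ^~ y) (uyx x y)]) ->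
  (forall e : R, 0 < e -> exists2 d : R, 0 < d & forall x y,
    `|x - x0| < d -> `|y - y0| < d -> `|uxy x y - uxy x0 y0| < e) ->
  (forall e : R, 0 < e -> exists2 d : R, 0 < d & forall x y,
    `|x - x0| < d -> `|y - y0| < d -> `|uyx x y - uyx x0 y0| < e) ->
  uxy x0 y0 = uyx x0 y0.
Proof.
move=> d00 HD c1 c2; apply/eqP/negP => /negP ne.
set a := uxy x0 y0 in ne c1 *; set b := uyx x0 y0 in ne c2 *.
have e0 : 0 < `|a - b| / 2 by rewrite divr_gt0// normr_gt0 subr_eq0.
have [d1 d10 H1] := c1 _ e0; have [d2 d20 H2] := c2 _ e0.
have d12 : 0 < Num.min d1 d2 by rewrite lt_min d10.
have [h [h0 hd0]] := exists_lt2 d00 d12.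
rewrite lt_min => /andP[hd1 hd2].
have nr (w v : R) : w <= v <= w + h -> `|v - w| <= h.
  by rewrite -lerBlDl -subr_ge0 => /andP[? ?]; rewrite ger0_norm.
have nr' (w v : R) : w < v < w + h -> `|v - w| <= h.
  by move=> /andP[? ?]; apply: nr; rewrite !ltW.
have {}HD x y : `|x - x0| <= h -> `|y - y0| <= h ->
    [/\ is_derive x 1 (u ^~ y) (ux x y), is_derive y 1 (u x) (uy x y),
       is_derive y 1 (ux x) (uxy x y) & is_derive x 1 (uy ^~ y) (uyx x y)].
  by move=> sx yy; apply: HD; apply: le_lt_trans hd0.
have wh (w : R) : w < w + h by rewrite ltrDl.
have hh (w : R) : `|w + h - w| <= h by rewrite addrC addKr gtr0_norm.
have w0 (w : R) : `|w - w| <= h by rewrite subrr normr0 ltW.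
have [|x1 /nr' x1h E1] := @MVT_is_derive _ (fun s => u s (y0 + h) - u s y0)
   (fun s => ux s (y0 + h) - ux s y0) x0 (x0 + h) (wh x0).
  move=> s /nr sh; have [? _ _ _] := HD s (y0 + h) sh (hh _).
  by have [? _ _ _] := HD s y0 sh (w0 _); exact: is_deriveB.
have [|y1 /nr' y1h E1'] := @MVT_is_derive _ (ux x1) (uxy x1) _ _ (wh y0).
  by move=> y /nr yh; have [] := HD x1 y x1h yh.
have [|y2 /nr' y2h E2] := @MVT_is_derive _ (fun y => u (x0 + h) y - u x0 y)
   (fun y => uy (x0 + h) y - uy x0 y) y0 (y0 + h) (wh y0).
  move=> s /nr sh; have [_ ? _ _] := HD (x0 + h) s (hh _) sh.
  by have [_ ? _ _] := HD x0 s (w0 _) sh; exact: is_deriveB.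
have [|x2 /nr' x2h E2'] := @MVT_is_derive _ (uy ^~ y2) (uyx ^~ y2) _ _ (wh x0).
  by move=> x /nr xh; have [] := HD x y2 xh y2h.
have := H1 x1 y1 (le_lt_trans x1h hd1) (le_lt_trans y1h hd1).
have := H2 x2 y2 (le_lt_trans x2h hd2) (le_lt_trans y2h hd2).
have -> : uyx x2 y2 = uxy x1 y1.
  apply: (@mulIf _ (h * h)); first by rewrite mulf_neq0// gt_eqF.
  rewrite /= ![_ + h - _]addrC !addKr in E1 E1' E2 E2'.
  by rewrite !mulrA -E1' -E2' -E1 -E2; ring.
move: (uxy x1 y1) => m m2 m1.
have : `|a - b| < `|a - b| / 2 + `|a - b| / 2.
  rewrite {1}(_ : a - b = (m - b) - (m - a)); last by ring.
  by apply: (le_lt_trans (ler_normB _ _)); exact: ltrD.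
by rewrite -splitr ltxx.
Qed.

End planar_calculus.

(** The derivatives are explicit functions, so that reflections and linear combinations are handled
    term by term. One function [uxy] serves both mixed derivatives, as cross-differentiating the
    first-order system requires; continuity of [u] gives maxima on compact boxes. *)
Record C2_data (R : realType) (D : R -> R -> Prop)
    (u ux uy uxx uxy uyy : R -> R -> R) : Prop := C2Data {
  C2_x : forall x y, D x y -> is_derive x 1 (u ^~ y) (ux x y);
  C2_y : forall x y, D x y -> is_derive y 1 (u x) (uy x y);
  C2_xx : forall x y, D x y -> is_derive x 1 (ux ^~ y) (uxx x y);
  C2_xy : forall x y, D x y -> is_derive y 1 (ux x) (uxy x y);
  C2_yx : forall x y, D x y -> is_derive x 1 (uy ^~ y) (uxy x y);
  C2_yy : forall x y, D x y -> is_derive y 1 (uy x) (uyy x y);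
  C2_cont : forall x y, D x y -> {for (x, y), continuous (fun z => u z.1 z.2)} }.

Lemma is_C2_on_data (R : realType) (D : set (R * R)) (u : R * R -> R) :
  open D -> is_C2_on D u ->
  C2_data (fun x y => D (x, y)) (fun x y => u (x, y))
    (fun x y => 'D_((1, 0) : R * R) u (x, y))
    (fun x y => 'D_((0, 1) : R * R) u (x, y))
    (fun x y => 'D_((1, 0) : R * R) ('D_((1, 0) : R * R) u) (x, y))
    (fun x y => 'D_((0, 1) : R * R) ('D_((1, 0) : R * R) u) (x, y))
    (fun x y => 'D_((0, 1) : R * R) ('D_((0, 1) : R * R) u) (x, y)).
Proof.
move=> oD [C1 C1x C1y].
have dx x y Dz := is_derive_ex (proj1 (C1 (x, y) Dz _ (or_introl erefl))).
have dy x y Dz := is_derive_ey (proj1 (C1 (x, y) Dz _ (or_intror erefl))).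
have dxx x y Dz := is_derive_ex (proj1 (C1x (x, y) Dz _ (or_introl erefl))).
have dxy x y Dz := is_derive_ey (proj1 (C1x (x, y) Dz _ (or_intror erefl))).
have dyx x y Dz := is_derive_ex (proj1 (C1y (x, y) Dz _ (or_introl erefl))).
have dyy x y Dz := is_derive_ey (proj1 (C1y (x, y) Dz _ (or_intror erefl))).
split; [exact: dx|exact: dy|exact: dxx|exact: dxy| |exact: dyy|].
- move=> x y Dz; have [d d0 Dd] := open_box oD Dz.
  rewrite (@mixed_derive R (fun x y => u (x, y))
    (fun x y => 'D_((1, 0) : R * R) u (x, y))
    (fun x y => 'D_((0, 1) : R * R) u (x, y))
    (fun x y => 'D_((0, 1) : R * R) ('D_((1, 0) : R * R) u) (x, y))
    (fun x y => 'D_((1, 0) : R * R) ('D_((0, 1) : R * R) u) (x, y)) x y d d0).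
  + exact: dyx.
  + by move=> s t sd td; have Dst := Dd _ _ sd td; split;
      [exact: dx|exact: dy|exact: dxy|exact: dyx].
  + move=> e e0.
    by have [h h0 H] := continuous_box (proj2 (C1x _ Dz _ (or_intror erefl))) e0; exists h.
  + move=> e e0.
    by have [h h0 H] := continuous_box (proj2 (C1y _ Dz _ (or_introl erefl))) e0; exists h.
- move=> x y Dz.
  rewrite (_ : (fun z : R * R => u (z.1, z.2)) = u); last by apply/funext => -[].
  exact: is_C1_on_continuous Dz.
Qed.

(** * Gradient estimates by the maximum principle *)

Section maximum_principle.
Context {R : realType}.

Section continuous_at_ops.
Context {T : topologicalType}.
Implicit Types (f g : T -> R) (p : T).

Lemma for_continuousD f g p : {for p, continuous f} -> {for p, continuous g} ->
  {for p, continuous (fun q => f q + g q)}.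
Proof. exact: cvgD. Qed.

Lemma for_continuousB f g p : {for p, continuous f} -> {for p, continuous g} ->
  {for p, continuous (fun q => f q - g q)}.
Proof. exact: cvgB. Qed.

Lemma for_continuousM f g p : {for p, continuous f} -> {for p, continuous g} ->
  {for p, continuous (fun q => f q * g q)}.
Proof. exact: cvgM. Qed.

Lemma for_continuous_pair (f g : T -> R) (u : R -> R -> R) p :
  {for p, continuous f} -> {for p, continuous g} ->
  {for (f p, g p), continuous (fun z => u z.1 z.2)} ->
  {for p, continuous (fun q => u (f q) (g q))}.
Proof.
move=> cf cg cu; apply: (@continuous_comp _ _ _ (fun q => (f q, g q))
  (fun z : R * R => u z.1 z.2)) => //.
exact: (cvg_pair cf cg).
Qed.

End continuous_at_ops.

Lemma is_derive_shiftr (f : R -> R) (x t d : R) :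
  is_derive (x + t) 1 f d -> is_derive x 1 (fun s => f (s + t)) d.
Proof.
move=> fd; rewrite -[d]mulr1.
by apply: (@is_derive1_comp _ f (fun s => s + t)) => //; exact: is_derive_shift.
Qed.

Lemma is_derive_shiftl (f : R -> R) (x t d : R) :
  is_derive (x + t) 1 f d -> is_derive t 1 (fun s => f (x + s)) d.
Proof.
by rewrite addrC => /is_derive_shiftr; under eq_fun do rewrite addrC.
Qed.

Lemma is_derive_shiftB (f : R -> R) (x t d : R) :
  is_derive (x - t) 1 f d -> is_derive t 1 (fun s => f (x - s)) (- d).
Proof.
move=> fd; rewrite -mulrN1; apply: (@is_derive1_comp _ f (fun s => x - s)) => //.
by rewrite -sub0r; apply: is_deriveB.
Qed.

(** With [A = 0] the same rule differentiates the affine derivative of a quadratic barrier; this is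
    where terms such as [0 * (x - 0) ^+ 2] come from. *)
Lemma is_derive_sub_quad (f : R -> R) (f' A B C x0 x : R) : is_derive x 1 f f' ->
  is_derive x 1 (fun x => f x - (A * (x - x0) ^+ 2 + B * x + C))
    (f' - (2 * A * (x - x0) + B)).
Proof.
move=> df; apply: is_deriveB.
have dg : is_derive x 1 (fun x : R => x - x0) 1 by exact: is_derive_shift.
have := is_deriveD (is_deriveD (is_deriveZ A (is_deriveM dg dg))
  (is_deriveZ B (is_derive_id x (1 : R)))) (is_derive_cst C x 1).
rewrite (_ : _ + cst C = (fun y => A * (y - x0) ^+ 2 + B * y + C)); last first.
  by apply/funext => y; rewrite expr2.
by move=> [dd de]; apply: DeriveDef => //; rewrite de /GRing.scale/=; ring.
Qed.

(** This is the [t]-part of the barrier used below, up to the factor [M / s ^ 2]. Taking [17 + 8 l]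
    as [13 + 8 l] plus 4 keeps it nonnegative on the box and makes it at least [2 * s ^ 2] on the
    face [t = s / 2]. *)
Lemma barrier_t_ge0 (l s t : R) : 0 <= l -> 0 <= t -> t <= s / 2 ->
  0 <= (17 + 8 * l) * s * t - (13 + 8 * l) * t ^+ 2.
Proof.
move=> l0 t0 ts.
have -> : (17 + 8 * l) * s * t - (13 + 8 * l) * t ^+ 2 =
  t * ((13 + 8 * l) * (s - t) + 4 * s) by ring.
by apply: mulr_ge0 => //; apply: addr_ge0; [apply: mulr_ge0|]; lra.
Qed.

Lemma barrier_face_t (l s : R) : 0 <= l ->
  2 * s ^+ 2 <= (17 + 8 * l) * s * (s / 2) - (13 + 8 * l) * (s / 2) ^+ 2.
Proof.
move=> l0.
have -> : (17 + 8 * l) * s * (s / 2) - (13 + 8 * l) * (s / 2) ^+ 2 =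
  (21 / 4 + 2 * l) * s ^+ 2 by field.
by rewrite ler_wpM2r ?sqr_ge0//; lra.
Qed.

(** The average of the two bounds on [exx] is [- (5 + 8 l) q]; the bound [4 q] on [eyy] and [8 l q]
    on the first-order term leave a total of at most [- q], against a nonnegative right-hand side.
    The [8 l] in [13 + 8 l] is there to absorb the singular first-order term. *)
Lemma barrier_contradiction (l k q w y y0 exx eyy ey : R) :
  0 <= l -> 0 < q -> 0 < y -> 0 < y0 -> 0 <= k * (w / y ^+ 2) ->
  exx + eyy + 2 * l * (ey / y) = k * (w / y ^+ 2) ->
  exx - 16 * q <= 0 -> exx + 2 * (13 + 8 * l) * q <= 0 ->
  eyy - 4 * q <= 0 -> ey - 4 * q * (y - y0) = 0 -> False.
Proof.
move=> l0 q0 y_gt0 y00 kw pde hxx htt hyy /eqP; rewrite subr_eq0 => /eqP hy.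
have : 2 * l * (ey / y) <= 8 * l * q.
  rewrite hy; have -> : 2 * l * (4 * q * (y - y0) / y) =
    8 * l * q - 8 * l * q * (y0 / y) by field; rewrite gt_eqF.
  by rewrite gerBl mulr_ge0 ?divr_ge0 ?mulr_ge0// ltW.
by move: kw; rewrite -pde; nra.
Qed.

(* Maximum principle for [e * (u (x + t) y - u (x - t) y) - B x t y], where
   [B = M / s ^ 2 * (8 (x - x0)^2 + 2 (y - y0)^2 + (17 + 8 l) s t - (13 + 8 l) t^2)]
   is at least [2 M] on the outer faces of the box and a strict supersolution of
   [u_xx / 2 + u_tt / 2 + u_yy + 2 l u_y / y]. Since [y0 > 0], the slope of [B]
   in [y] excludes a maximum on the face [y = 0]. *)
Lemma x_oscillation (l k : R) (D : R -> R -> Prop) (u ux uy uxx uxy uyy : R -> R -> R)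
    (x0 y0 s M e t : R) :
  0 <= l -> 0 <= k -> C2_data D u ux uy uxx uxy uyy ->
  (forall x y, D x y -> 0 < y ->
    uxx x y + uyy x y + 2 * l * (uy x y / y) = k * (u x y / y ^+ 2)) ->
  (forall x, D x 0 -> u x 0 = 0) \/ (forall x, D x 0 -> uy x 0 = 0) ->
  0 < s -> 0 < y0 -> 0 < M -> `|e| = 1 ->
  (forall x y, `|x - x0| <= s -> `|y - y0| <= s -> 0 <= y ->
    D x y /\ `|u x y| <= M) ->
  0 <= t <= s / 2 ->
  e * (u (x0 + t) y0 - u (x0 - t) y0) <= (17 + 8 * l) * (M / s) * t.
Proof.
move=> l0 k0 C2 pde bd s0 y00 M0 e1 box t0s.
set b := 13 + 8 * l; set a := 17 + 8 * l.
set q := M / s ^+ 2.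
have q0 : 0 < q by rewrite divr_gt0// exprn_gt0.
have qs : q * s ^+ 2 = M by rewrite /q divfK// gt_eqF// exprn_gt0.
pose B x t y := q * (8 * (x - x0) ^+ 2 + 2 * (y - y0) ^+ 2 + a * s * t - b * t ^+ 2).
pose F x t y := e * (u (x + t) y - u (x - t) y) - B x t y.
pose G (p : R * R * R) := F p.1.1 p.1.2 p.2.
(* Halving the ranges of [x] and [t] keeps both [x + t] and [x - t] within [s] of [x0]. *)
pose K := (`[x0 - s / 2, x0 + s / 2] `*` `[0, s / 2]) `*` `[Num.max 0 (y0 - s), y0 + s].
have KP x t' y : K (x, t', y) <-> [/\ `|x - x0| <= s / 2, 0 <= t' <= s / 2, `|y - y0| <= s & 0 <= y].
  rewrite /K /= !in_itv/= ge_max; split.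
    by move=> [[/andP[? ?] ?] /andP[/andP[? ?] ?]]; split => //; rewrite ler_norml; lra.
  move=> [+ tt + yy]; rewrite !ler_norml => /andP[? ?] /andP[? ?].
  by split; [split=> //|]; rewrite ?yy/=; lra.
have Kbox x t' y : K (x, t', y) -> [/\ D (x + t') y, D (x - t') y,
    `|u (x + t') y| <= M & `|u (x - t') y| <= M].
  move=> /KP[+ /andP[t1 t2] yy yp]; rewrite ler_norml => /andP[x1 x2].
  have [|//|//|? ?] := box (x + t') y; first by rewrite ler_norml; lra.
  have [|//|//|? ?] := box (x - t') y; first by rewrite ler_norml; lra.
  by split.
have cK : compact K.
  by apply: compact_setX; [apply: compact_setX|]; exact: segment_compact.
have K0 : K (x0, t, y0).
  by apply/KP; rewrite !subrr !normr0 t0s; split=> //; lra.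
have cu := C2_cont C2.
have cG : {within K, continuous G}.
  apply: continuous_in_subspaceT => -[[x t'] y]; rewrite inE => /Kbox[Dp Dm _ _].
  have c11 : {for (x, t', y), continuous (fun p : R * R * R => p.1.1)}.
    by apply: (@continuous_comp _ _ _ fst fst); exact: cvg_fst.
  have c12 : {for (x, t', y), continuous (fun p : R * R * R => p.1.2)}.
    by apply: (@continuous_comp _ _ _ fst snd); [exact: cvg_fst|exact: cvg_snd].
  have c2 : {for (x, t', y), continuous (fun p : R * R * R => p.2)} by exact: cvg_snd.
  have cc (w : R) : {for (x, t', y), continuous (fun _ : R * R * R => w)} by exact: cst_continuous.
  rewrite /G /F /B /continuous_at; lazy beta; apply: cvgB.
    apply: cvgM; first exact: cc.
    apply: cvgB.
      apply: (@for_continuous_pair _ (fun p : R * R * R => p.1.1 + p.1.2) snd);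
        [exact: for_continuousD|exact: c2|exact: cu].
    apply: (@for_continuous_pair _ (fun p : R * R * R => p.1.1 - p.1.2) snd);
      [exact: for_continuousB|exact: c2|exact: cu].
  have sq (f : R * R * R -> R) w : {for (x, t', y), continuous f} ->
      {for (x, t', y), continuous (fun p => (f p - w) ^+ 2)}.
    by move=> cf; exact: (cvgM (cvgB cf (cc w)) (cvgB cf (cc w))).
  apply: cvgM; first exact: cc.
  apply: cvgB; last by apply: cvgM; [exact: cc|exact: (cvgM c12 c12)].
  apply: cvgD; last by apply: cvgM; [exact: cc|exact: c12].
  apply: cvgD; first by apply: cvgM; [exact: cc|exact: (sq _ x0 c11)].
  by apply: cvgM; [exact: cc|exact: (sq _ y0 c2)].
have [[[x1 t1] y1] /set_mem Kc maxc] := compact_EVT_max (ex_intro _ _ K0) cK cG.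
have {}maxc x t' y : K (x, t', y) -> F x t' y <= F x1 t1 y1.
  by move=> /mem_set /maxc.
suff Fc : F x1 t1 y1 <= 0.
  have := le_trans (maxc _ _ _ K0) Fc; rewrite /F subr_le0 => /le_trans; apply.
  rewrite /B !subrr expr0n/= !mulr0 !add0r -/a.
  have -> : a * (M / s) * t = q * (a * s * t) by rewrite /q; field; rewrite gt_eqF.
  by rewrite ler_pM2l// gerBl mulr_ge0 ?sqr_ge0// /b; lra.
rewrite leNgt; apply/negP => Fpos.
have [Dp Dm up um] := Kbox _ _ _ Kc.
have [x1s /andP[t10 t1s] y1s y10] := (KP _ _ _).1 Kc.
have W2 : e * (u (x1 + t1) y1 - u (x1 - t1) y1) <= 2 * M.
  rewrite (le_trans (ler_norm _))// normrM e1 mul1r (le_trans (ler_normB _ _))//.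
  by rewrite mulr2n mulrDl mul1r lerD.
have at_ge0 : 0 <= a * s * t1 - b * t1 ^+ 2.
  exact: barrier_t_ge0.
have B0 : 0 <= B x1 t1 y1.
  by rewrite mulr_ge0 ?(ltW q0)// -addrA addr_ge0// addr_ge0// mulr_ge0// sqr_ge0.
have BW : B x1 t1 y1 < 2 * M by rewrite (lt_le_trans _ W2)// -subr_gt0.
have BW' : 8 * (x1 - x0) ^+ 2 + 2 * (y1 - y0) ^+ 2 + (a * s * t1 - b * t1 ^+ 2) < 2 * s ^+ 2.
  by rewrite -(ltr_pM2l q0) (mulrCA q) qs addrA.
have x1lt : `|x1 - x0| < s / 2.
  rewrite lt_neqAle x1s andbT; apply/eqP => xs.
  move: BW'; rewrite -[(x1 - x0) ^+ 2]real_normK ?num_real// xs ltNge => /negP; apply.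
  rewrite (_ : 8 * (s / 2) ^+ 2 = 2 * s ^+ 2); last by field.
  by rewrite -addrA lerDl addr_ge0// mulr_ge0// sqr_ge0.
have y1lt : `|y1 - y0| < s.
  rewrite lt_neqAle y1s andbT; apply/eqP => xs.
  move: BW'; rewrite -[(y1 - y0) ^+ 2]real_normK ?num_real// xs ltNge => /negP; apply.
  by rewrite addrAC lerDr addr_ge0// mulr_ge0// sqr_ge0.
have t1lt : t1 < s / 2.
  rewrite lt_neqAle t1s andbT; apply/eqP => ts.
  move: BW'; rewrite ts ltNge => /negP; apply.
  by apply: (le_trans (barrier_face_t s l0)); rewrite lerDr addr_ge0// mulr_ge0// sqr_ge0.
(* On the face [t = 0] the oscillation vanishes while the barrier is nonnegative. *)
have t1gt : 0 < t1.
  rewrite lt_neqAle t10 andbT; apply/eqP => ts.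
  move: Fpos B0; rewrite /F -ts addr0 subr0 subrr mulr0 sub0r oppr_gt0.
  by move=> h1 h2; have := lt_le_trans h1 h2; rewrite ltxx.
have W0 : 0 < e * (u (x1 + t1) y1 - u (x1 - t1) y1).
  by rewrite (le_lt_trans B0)// -subr_gt0.
have dFy y : D (x1 + t1) y -> D (x1 - t1) y -> is_derive y 1 (F x1 t1)
    (e * (uy (x1 + t1) y - uy (x1 - t1) y) - (2 * (2 * q) * (y - y0) + 0)).
  move=> d1 d2; have := @is_derive_sub_quad (fun y => e * (u (x1 + t1) y - u (x1 - t1) y))
    (e * (uy (x1 + t1) y - uy (x1 - t1) y)) (2 * q) 0
    (q * (8 * (x1 - x0) ^+ 2 + a * s * t1 - b * t1 ^+ 2)) y0 y.
  rewrite (_ : (fun y : R => _ - _) = F x1 t1); last first.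
    by apply/funext => w; rewrite /F /B; ring.
  by apply; apply: is_deriveZ; apply: is_deriveB; exact: (C2_y C2).
(* On the axis, the Dirichlet condition makes the oscillation vanish; the Neumann condition leaves
   [F] the slope [4 * q * y0 > 0] in [y], so that it increases into the box. *)
have [y1_0|y1_gt0] : y1 = 0 \/ 0 < y1.
  by move: y10; rewrite le_eqVlt => /predU1P[->|]; [left|right].
  have Dp0 : D (x1 + t1) 0 by rewrite -y1_0.
  have Dm0 : D (x1 - t1) 0 by rewrite -y1_0.
  case: bd => bd.
    by move: W0; rewrite y1_0 (bd _ Dp0) (bd _ Dm0) subrr mulr0 ltxx.
  have dF := dFy _ Dp0 Dm0.
  rewrite (bd _ Dp0) (bd _ Dm0) subrr mulr0 sub0r addr0 sub0r in dF.
  have /(is_derive_left_max s0 dF) : forall y, 0 < y < s -> F x1 t1 (0 + y) <= F x1 t1 0.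
    move=> y /andP[ya yb]; rewrite add0r -[X in _ <= F _ _ X]y1_0; apply: maxc; apply/KP; split=> //.
    - by rewrite t10.
    - rewrite ler_norml; move: y1lt; rewrite y1_0 ltr_norml; clear -ya yb y00; lra.
    - exact: ltW.
  rewrite leNgt mulrN opprK mulr_gt0//; clear -q0; lra.
have [d0 d00 hd] : exists2 d : R, 0 < d & forall v, `|v| < d ->
   [/\ K (x1 + v, t1, y1), K (x1, t1 + v, y1) & K (x1, t1, y1 + v)].
  exists (Num.min (s / 2 - `|x1 - x0|) (Num.min (s / 2 - t1)
     (Num.min (s - `|y1 - y0|) (Num.min t1 y1)))).
    by rewrite !lt_min !subr_gt0 x1lt t1lt y1lt t1gt y1_gt0.
  move=> v; rewrite !lt_min => /and5P[v1 v2 v3].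
  rewrite !ltr_norml => /andP[v4 v5] /andP[v6 v7].
  have nv w : `|w + v| <= `|w| + `|v| := ler_normD _ _.
  have x1v : `|x1 + v - x0| <= s / 2.
    by rewrite addrAC; apply/ltW/(le_lt_trans (nv _)); rewrite -ltrBrDl.
  have y1v : `|y1 + v - y0| <= s.
    by rewrite addrAC; apply/ltW/(le_lt_trans (nv _)); rewrite -ltrBrDl.
  have t1v : 0 <= t1 + v <= s / 2.
    rewrite -lerBlDl sub0r ltW//= -lerBrDl ltW//.
    by apply: le_lt_trans v2; exact: ler_norm.
  have y1v0 : 0 <= y1 + v by rewrite -lerBlDl sub0r ltW.
  by split; apply/KP; split=> //; rewrite t10.
have KD v y : K (v, y, y1) -> D (v + y) y1 /\ D (v - y) y1 by move=> /Kbox[].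
have KDy y : K (x1, t1, y) -> D (x1 + t1) y /\ D (x1 - t1) y by move=> /Kbox[].
have nearE (c v : R) : v = c + (v - c) by rewrite addrC subrK.
have [|||_ hxx] := @second_derive_max _ (fun x => F x t1 y1)
    (fun x => e * (ux (x + t1) y1 - ux (x - t1) y1) -
       (0 * (x - 0) ^+ 2 + 16 * q * x + 16 * q * - x0)) x1
    (e * (uxx (x1 + t1) y1 - uxx (x1 - t1) y1) - (2 * 0 * (x1 - 0) + 16 * q)) _ d00.
  - move=> x /hd[]; rewrite -nearE => /KD[da db] _ _.
    have := @is_derive_sub_quad (fun x => e * (u (x + t1) y1 - u (x - t1) y1))
      (e * (ux (x + t1) y1 - ux (x - t1) y1)) (8 * q) 0
      (q * (2 * (y1 - y0) ^+ 2 + a * s * t1 - b * t1 ^+ 2)) x0 x.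
    rewrite (_ : (fun y : R => _ - _) = (fun x => F x t1 y1)); last first.
      by apply/funext => w; rewrite /F /B; ring.
    rewrite (_ : 2 * _ * _ + 0 = 0 * (x - 0) ^+ 2 + 16 * q * x + 16 * q * - x0); last by ring.
    apply; apply: is_deriveZ; apply: is_deriveB.
      by apply: (@is_derive_shiftr (u ^~ y1)); exact: (C2_x C2 da).
    by apply: (@is_derive_shiftr (u ^~ y1)); exact: (C2_x C2 db).
  - apply: is_derive_sub_quad; apply: is_deriveZ.
    apply: is_deriveB.
      by apply: (@is_derive_shiftr (ux ^~ y1)); exact: (C2_xx C2 Dp).
    by apply: (@is_derive_shiftr (ux ^~ y1)); exact: (C2_xx C2 Dm).
  - by move=> x /hd[]; rewrite -nearE => /maxc.
(* The oscillation has the same second derivative in [t] as in [x], so the concavity of the barrier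
   in [t] yields a strictly negative bound on it. *)
have [|||_ htt] := @second_derive_max _ (fun t => F x1 t y1)
    (fun t => e * (ux (x1 + t) y1 + ux (x1 - t) y1) -
       (0 * (t - 0) ^+ 2 + - (2 * b * q) * t + q * a * s)) t1
    (e * (uxx (x1 + t1) y1 - uxx (x1 - t1) y1) - (2 * 0 * (t1 - 0) - 2 * b * q)) _ d00.
  - move=> v /hd[_]; rewrite -nearE => /KD[da db] _.
    have := @is_derive_sub_quad (fun t => e * (u (x1 + t) y1 - u (x1 - t) y1))
      (e * (ux (x1 + v) y1 + ux (x1 - v) y1)) (- (b * q)) (q * a * s)
      (q * (8 * (x1 - x0) ^+ 2 + 2 * (y1 - y0) ^+ 2)) 0 v.
    rewrite (_ : (fun y : R => _ - _) = (fun t => F x1 t y1)); last first.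
      by apply/funext => w; rewrite /F /B; ring.
    rewrite (_ : 2 * _ * _ + _ = 0 * (v - 0) ^+ 2 + - (2 * b * q) * v + q * a * s); last by ring.
    apply; apply: is_deriveZ; rewrite -[ux (x1 - v) y1]opprK; apply: is_deriveB.
      by apply: (@is_derive_shiftl (u ^~ y1)); exact: (C2_x C2 da).
    by apply: (@is_derive_shiftB (u ^~ y1)); exact: (C2_x C2 db).
  - apply: is_derive_sub_quad; apply: is_deriveZ; apply: is_deriveD.
      by apply: (@is_derive_shiftl (ux ^~ y1)); exact: (C2_xx C2 Dp).
    by apply: (@is_derive_shiftB (ux ^~ y1)); exact: (C2_xx C2 Dm).
  - by move=> v /hd[_]; rewrite -nearE => /maxc.
have [hy hyy] : e * (uy (x1 + t1) y1 - uy (x1 - t1) y1) - (2 * (2 * q) * (y1 - y0) + 0) = 0 /\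
    e * (uyy (x1 + t1) y1 - uyy (x1 - t1) y1) - (2 * 0 * (y1 - 0) + 4 * q) <= 0.
  apply: (@second_derive_max _ (F x1 t1)
    (fun y => e * (uy (x1 + t1) y - uy (x1 - t1) y) -
       (2 * (2 * q) * (y - y0) + 0)) y1 _ _ d00).
  - by move=> y /hd[_ _]; rewrite -nearE => /KDy[da db]; exact: dFy.
  - rewrite (_ : (fun y => _) = (fun y => e * (uy (x1 + t1) y - uy (x1 - t1) y) -
       (0 * (y - 0) ^+ 2 + 4 * q * y + 4 * q * - y0))); last first.
      by apply/funext => y; ring.
    apply: is_derive_sub_quad; apply: is_deriveZ.
    by apply: is_deriveB; [exact: (C2_yy C2 Dp)|exact: (C2_yy C2 Dm)].
  - by move=> v /hd[_ _]; rewrite -nearE => /maxc.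
(* The zero-order term has the favourable sign because the oscillation is positive at the
   maximum. *)
have kW : 0 <= k * (e * (u (x1 + t1) y1 - u (x1 - t1) y1) / y1 ^+ 2).
  by rewrite mulr_ge0// divr_ge0 ?sqr_ge0// ltW.
apply: (barrier_contradiction l0 q0 y1_gt0 y00 kW
   (exx := e * (uxx (x1 + t1) y1 - uxx (x1 - t1) y1))
   (eyy := e * (uyy (x1 + t1) y1 - uyy (x1 - t1) y1))
   (ey := e * (uy (x1 + t1) y1 - uy (x1 - t1) y1))).
- have := pde _ _ Dp y1_gt0; have := pde _ _ Dm y1_gt0 => h1 h2.
  rewrite (_ : k * _ = e * (k * (u (x1 + t1) y1 / y1 ^+ 2) - k * (u (x1 - t1) y1 / y1 ^+ 2))); last by ring.
  by rewrite -h1 -h2; ring.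
- by apply: le_trans hxx; rewrite le_eqVlt; apply/orP; left; apply/eqP; ring.
- by apply: le_trans htt; rewrite le_eqVlt; apply/orP; left; apply/eqP; rewrite /b; ring.
- by apply: le_trans hyy; rewrite le_eqVlt; apply/orP; left; apply/eqP; ring.
- by rewrite -[RHS]hy; ring.
Qed.

End maximum_principle.

(** * Gradient bounds for the generalized Cauchy-Riemann system *)

Section axial_pairs.
Context {R : realType}.

(** Both sides of the oscillation bound vanish at [t = 0], so comparing right derivatives there
    gives [2 * e * ux <= c], for either sign [e]; since [c >= 0], this implies [e * ux <= c]. *)
Lemma x_derivative_bound (l k : R) (D : R -> R -> Prop) (u ux uy uxx uxy uyy : R -> R -> R)
    (x0 y0 s M : R) :
  0 <= l -> 0 <= k -> C2_data D u ux uy uxx uxy uyy ->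
  (forall x y, D x y -> 0 < y ->
    uxx x y + uyy x y + 2 * l * (uy x y / y) = k * (u x y / y ^+ 2)) ->
  (forall x, D x 0 -> u x 0 = 0) \/ (forall x, D x 0 -> uy x 0 = 0) ->
  0 < s -> 0 < y0 -> 0 < M ->
  (forall x y, `|x - x0| <= s -> `|y - y0| <= s -> 0 <= y ->
    D x y /\ `|u x y| <= M) ->
  `|ux x0 y0| <= (17 + 8 * l) * (M / s).
Proof.
move=> l0 k0 C2 pde bd s0 y00 M0 box.
have D0 : D x0 y0 by apply: (proj1 (box _ _ _ _ _)); rewrite ?subrr ?normr0 ltW.
set c := (17 + 8 * l) * (M / s).
have c0 : 0 <= c by rewrite mulr_ge0 ?divr_ge0 ?(ltW M0) ?(ltW s0)//; clear -l0; lra.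
have Ux e : `|e| = 1 -> e * ux x0 y0 <= c.
  move=> e1.
  have dU t : x0 + t = x0 -> x0 - t = x0 -> is_derive t 1
     (fun t => e * (u (x0 + t) y0 - u (x0 - t) y0) - (0 * (t - 0) ^+ 2 + c * t + 0))
     (e * (ux x0 y0 + ux x0 y0) - (2 * 0 * (t - 0) + c)).
    move=> et1 et2; apply: is_derive_sub_quad; apply: is_deriveZ.
    rewrite -{2}[ux x0 y0]opprK; apply: is_deriveB.
      by apply: (@is_derive_shiftl _ (u ^~ y0)); rewrite et1; exact: (C2_x C2).
    by apply: (@is_derive_shiftB _ (u ^~ y0)); rewrite et2; exact: (C2_x C2).
  have s20 : 0 < s / 2 by rewrite divr_gt0.
  have := is_derive_left_max s20 (dU 0 (addr0 _) (subr0 _)).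
  have H0 : e * (ux x0 y0 + ux x0 y0) - (2 * 0 * (0 - 0) + c) <= 0 -> e * ux x0 y0 <= c.
    clear -c0; move: (ux x0 y0) => w; lra.
  move=> H; apply: H0; apply: H => t /andP[t0 ts].
  rewrite /= !add0r !mul0r !mulr0 !add0r !addr0 !subr0 subrr mulr0 subr_le0.
  by apply: (x_oscillation l0 k0 C2 pde bd) => //; rewrite !ltW.
rewrite ler_norml -[ux x0 y0]mul1r Ux ?normr1//.
by rewrite lerNl -mulNr Ux// normrN1.
Qed.

Lemma is_derive_near_eq (f g : R -> R) (x a b d : R) : 0 < d ->
  (forall s, `|s - x| < d -> f s = g s) ->
  is_derive x 1 f a -> is_derive x 1 g b -> a = b.
Proof.
move=> d0 fg df dg.
have fgx : \near x, f x = g x.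
  by exists d => //= s /=; rewrite distrC; exact: fg.
by have [_ <-] := near_eq_is_derive fgx df; have [_ ->] := dg.
Qed.

(* The real form of [D_zbar f = 0]: [U] and [V] are the parts of [f] that are
   respectively even and odd under conjugation. *)
Record axial_pair (l : R) (D : R -> R -> Prop)
    (U Ux Uy V Vx Vy : R -> R -> R) : Prop := AxialPair {
  axial_open : forall x y, D x y ->
    exists2 d : R, 0 < d & forall s t, `|s - x| < d -> `|t - y| < d -> D s t;
  axial_U : exists Uxx Uxy Uyy, C2_data D U Ux Uy Uxx Uxy Uyy;
  axial_V : exists Vxx Vxy Vyy, C2_data D V Vx Vy Vxx Vxy Vyy;
  axial_eq1 : forall x y, D x y -> 0 < y ->
    Ux x y = Vy x y + 2 * l * (V x y / y);
  axial_eq2 : forall x y, D x y -> 0 < y -> Uy x y = - Vx x y;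
  axial_V0 : forall x, D x 0 -> V x 0 = 0;
  axial_Uy0 : forall x, D x 0 -> Uy x 0 = 0 }.

Lemma distance_near_axis (t y y0 s : R) : 0 <= t -> t <= y0 -> y0 <= s / 2 ->
  0 <= y -> `|y - t| <= s / 2 -> `|y - y0| <= s.
Proof. by rewrite !ler_norml => t0 ty ys y_ge0 /andP[h1 h2]; apply/andP; split; lra. Qed.

Section pair.
Variables (l : R) (D : R -> R -> Prop) (U Ux Uy V Vx Vy : R -> R -> R).
Hypotheses (l0 : 0 <= l) (UV : axial_pair l D U Ux Uy V Vx Vy).

(** Differentiating the two first-order equations in [x] and in [y] eliminates the mixed derivative
    of [V]. The factor 0 puts the equation in the common form of the barrier argument, with
    [k = 0]. *)
Lemma axial_pde_U Uxx Uxy Uyy x y : C2_data D U Ux Uy Uxx Uxy Uyy ->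
  D x y -> 0 < y -> Uxx x y + Uyy x y + 2 * l * (Uy x y / y) = 0 * (U x y / y ^+ 2).
Proof.
move=> CU Dxy y0; have [Vxx [Vxy [Vyy CV]]] := axial_V UV.
have [d d0 Dd] := axial_open UV Dxy.
have dd (w : R) : `|w - w| < d by rewrite subrr normr0.
have -> : Uxx x y = Vxy x y + 2 * l * (Vx x y / y).
  apply: (is_derive_near_eq d0 _ (CU.(C2_xx) Dxy)
    (g := fun s => Vy s y + 2 * l * (V s y / y))).
    by move=> s sx; apply: (axial_eq1 UV) => //; exact: Dd.
  apply: is_deriveD; first exact: (C2_yx CV).
  apply: is_deriveZ; rewrite [_ / y]mulrC.
  under eq_fun do rewrite [_ / y]mulrC.
  by apply: is_deriveZ; exact: (C2_x CV).
have -> : Uyy x y = - Vxy x y.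
  have [e [e0 ed ey]] := exists_lt2 d0 y0.
  apply: (is_derive_near_eq e0 _ (CU.(C2_yy) Dxy) (g := fun t => - Vx x t)).
    move=> t ty; apply: (axial_eq2 UV).
      by apply: Dd => //; exact: lt_trans ed.
    by move: ty; rewrite ltr_distl => /andP[+ _]; apply: lt_trans; rewrite subr_gt0.
  by apply: is_deriveN; exact: (C2_xy CV).
rewrite (axial_eq2 UV Dxy y0); ring.
Qed.

(** The same elimination, except that differentiating [V / y] in [y] creates the zero-order term, so
    [k = 2 * l]. *)
Lemma axial_pde_V Vxx Vxy Vyy x y : C2_data D V Vx Vy Vxx Vxy Vyy ->
  D x y -> 0 < y -> Vxx x y + Vyy x y + 2 * l * (Vy x y / y) = 2 * l * (V x y / y ^+ 2).
Proof.
move=> CV Dxy y0; have [Uxx [Uxy [Uyy CU]]] := axial_U UV.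
have [d d0 Dd] := axial_open UV Dxy.
have dd (w : R) : `|w - w| < d by rewrite subrr normr0.
have yn0 : y != 0 by rewrite gt_eqF.
have -> : Vxx x y = - Uxy x y.
  apply: (is_derive_near_eq d0 _ (CV.(C2_xx) Dxy) (g := fun s => - Uy s y)).
    by move=> s sx; rewrite (axial_eq2 UV) ?opprK//; exact: Dd.
  by apply: is_deriveN; exact: (C2_yx CU).
have -> : Vyy x y = Uxy x y - 2 * l * (Vy x y / y - V x y / y ^+ 2).
  have [e [e0 ed ey]] := exists_lt2 d0 y0.
  apply: (is_derive_near_eq e0 _ (CV.(C2_yy) Dxy)
    (g := fun t => Ux x t - 2 * l * (V x t * t^-1))).
    move=> t ty; rewrite (axial_eq1 UV) ?addrK//.
      by apply: Dd => //; exact: lt_trans ed.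
    by move: ty; rewrite ltr_distl => /andP[+ _]; apply: lt_trans; rewrite subr_gt0.
  apply: is_deriveB; first exact: (C2_xy CU).
  apply: is_deriveZ.
  have := is_deriveM (C2_y CV Dxy) (is_deriveV yn0 (is_derive_id y 1)).
  move=> [dd1 de]; apply: DeriveDef => //; rewrite de /GRing.scale/=; field.
  exact: yn0.
rewrite mulrBr; ring.
Qed.

(** At a positive maximum of [f t - k' * t] one has [t > 0], [f t > 0] and [f' t >= k']; the
    singular term only adds to the left-hand side, which contradicts [k < k']. It serves to bound
    [V / y] near the axis through the first equation. *)
Lemma odd_growth (f f' : R -> R) (y k k' : R) : 0 < y -> 0 <= k -> k < k' ->
  (forall t, 0 <= t <= y -> is_derive t 1 f (f' t)) -> f 0 = 0 ->
  (forall t, 0 < t <= y -> f' t + 2 * l * (f t / t) <= k) -> f y <= k' * y.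
Proof.
move=> y0 k0 kk' df f0 Hf; rewrite leNgt; apply/negP => fy.
pose h t := f t - (0 * (t - 0) ^+ 2 + k' * t + 0).
have dh t : 0 <= t <= y -> is_derive t 1 h (f' t - (2 * 0 * (t - 0) + k')).
  by move=> /df; exact: is_derive_sub_quad.
have [|c + hc] := @EVT_max _ h 0 y (ltW y0).
  apply: continuous_in_subspaceT => t; rewrite inE/= in_itv/= => /dh.
  exact: continuous_is_derive.
rewrite in_itv/= => /andP[c0 cy].
have hcpos : 0 < h c.
  have := hc y; rewrite in_itv/= lexx ltW// => /(_ isT); apply: lt_le_trans.
  by rewrite /h mul0r add0r addr0 subr_gt0.
have {}c0 : 0 < c.
  rewrite lt_neqAle c0 andbT; apply/eqP => c0'.
  by move: hcpos; rewrite -c0' /h f0 mul0r mulr0 !add0r oppr0 ltxx.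
have c0y : 0 <= c <= y by rewrite (ltW c0).
have : 0 <= f' c - (2 * 0 * (c - 0) + k').
  apply: (is_derive_right_max c0 (dh c c0y)) => t /andP[t0 tc]; apply: hc.
  by rewrite in_itv/= subr_ge0 (ltW tc)/= (le_trans _ cy)// gerBl ltW.
have := Hf c; rewrite c0 cy => /(_ isT) Hc.
have fc : 0 <= 2 * l * (f c / c).
  apply: mulr_ge0; first exact: mulr_ge0.
  apply: divr_ge0; last exact: ltW.
  move: hcpos; rewrite /h mul0r add0r addr0 subr_gt0 => /ltW; apply: le_trans.
  by rewrite mulr_ge0 ?(ltW c0)// (le_trans k0)// ltW.
rewrite mulr0 mul0r add0r subr_ge0 leNgt => /negP; apply.
apply: le_lt_trans kk'; apply: le_trans Hc; by rewrite lerDl.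
Qed.

(** The barrier bounds [Ux] and [Vx] by [c]; then [Uy = - Vx], and [Vy = Ux - 2 l V / y] is bounded
    as soon as [V / y] is. The factor [1 + 6 l] is [c + 2 l * 3 c] divided by [c]. *)
Lemma axial_gradient x0 y0 s M : 0 < s -> 0 < y0 -> 0 < M ->
  (forall x y, `|x - x0| <= s -> `|y - y0| <= s -> 0 <= y ->
    [/\ D x y, `|U x y| <= M & `|V x y| <= M]) ->
  let L := (17 + 8 * l) * (1 + 6 * l) * (M / s) in
  [/\ `|Ux x0 y0| <= L, `|Uy x0 y0| <= L, `|Vx x0 y0| <= L & `|Vy x0 y0| <= L].
Proof.
move=> s0 y00 M0 box L.
have [Uxx [Uxy [Uyy CU]]] := axial_U UV; have [Vxx [Vxy [Vyy CV]]] := axial_V UV.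
set c := (17 + 8 * l) * (M / s).
have Ms0 : 0 < M / s by rewrite divr_gt0.
have l8 : 0 < 17 + 8 * l by rewrite ltr_pwDl// mulr_ge0.
have c0 : 0 < c by exact: mulr_gt0.
have LE : L = c + 6 * l * c by rewrite /L /c; ring.
have cL : c <= L by rewrite LE lerDl; apply: mulr_ge0; [exact: mulr_ge0|exact: ltW].
have boundU x y : forall r, 0 < r -> 0 < y ->
   (forall x' y', `|x' - x| <= r -> `|y' - y| <= r -> 0 <= y' -> `|x' - x0| <= s /\ `|y' - y0| <= s) ->
    `|Ux x y| <= (17 + 8 * l) * (M / r).
  move=> r r0 y_0 sub.
  apply: (x_derivative_bound l0 (lexx 0) CU) => //.
  - by move=> ? ?; exact: (axial_pde_U CU).
  - by right; exact: (axial_Uy0 UV).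
  - by move=> x' y' h1 h2 h3; have [h4 h5] := sub _ _ h1 h2 h3; have [] := box _ _ h4 h5 h3.
have D0 : D x0 y0 by have [] := box x0 y0; rewrite ?subrr ?normr0 ?(ltW s0) ?(ltW y00).
have bU : `|Ux x0 y0| <= c by apply: boundU.
have bV : `|Vx x0 y0| <= c.
  apply: (x_derivative_bound l0 _ CV (k := 2 * l)) => //.
  - by rewrite mulr_ge0.
  - by move=> ? ?; exact: (axial_pde_V CV).
  - by left; exact: (axial_V0 UV).
  - by move=> x y h1 h2 h3; have [] := box _ _ h1 h2 h3.
(* If [y0 > s / 2], dividing [M] by [y0] costs only a factor [2 / s]. Otherwise [Ux] is bounded by
   [2 * c] on the whole segment down to the axis, using boxes of half the size, and [V = 0] at its
   foot. *)
have bVy : `|V x0 y0 / y0| <= 3 * c.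
  have [ys|sy] := leP y0 (s / 2).
    have s20 : 0 < s / 2 by rewrite divr_gt0.
    have Dt t : 0 <= t <= y0 -> D x0 t.
      move=> /andP[t0 ty]; have [] := box x0 t => //.
        by rewrite subrr normr0 ltW.
      by apply: (distance_near_axis t0 ty ys) => //; rewrite subrr normr0 ltW.
    have bUt t : 0 < t <= y0 -> `|Ux x0 t| <= 2 * c.
      move=> /andP[t0 ty]; rewrite (_ : 2 * c = (17 + 8 * l) * (M / (s / 2))).
        apply: boundU => // x' y' h1 h2 h3; split.
          by apply: (le_trans h1); rewrite ger_pMr// invf_le1// ler1n.
        exact: (distance_near_axis (ltW t0) ty ys).
      by rewrite /c; field; rewrite gt_eqF.
    have gen e : `|e| = 1 -> e * V x0 y0 <= 3 * c * y0.
      (* The comparison needs a strict gap: [2 * c] bounds the derivative expression and [3 * c] is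
         the resulting slope. *)
      move=> e1; apply: (@odd_growth (fun t => e * V x0 t) (fun t => e * Vy x0 t) _ (2 * c)) => //.
      - by rewrite mulr_ge0// ltW.
      - by rewrite ltr_pM2r// ltr_nat.
      - by move=> t /Dt Dt'; apply: is_deriveZ; exact: (C2_y CV).
      - by rewrite (axial_V0 UV) ?mulr0//; apply: Dt; rewrite lexx ltW.
      move=> t /[dup] /bUt + /andP[t0 ty].
      have Dxt : D x0 t by apply: Dt; rewrite (ltW t0).
      rewrite (axial_eq1 UV Dxt t0) => h.
      rewrite (_ : _ + _ = e * (Vy x0 t + 2 * l * (V x0 t / t))); last by ring.
      by rewrite (le_trans (ler_norm _))// normrM e1 mul1r.
    rewrite normrM normfV (gtr0_norm y00) ler_pdivrMr// ler_norml.
    by rewrite -[V x0 y0]mul1r gen ?normr1// andbT lerNl -mulNr gen// normrN1.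
  have [|||_ _ h] := box x0 y0; rewrite ?subrr ?normr0 ?(ltW s0) ?(ltW y00)//.
  rewrite normrM normfV (gtr0_norm y00).
  apply: (@le_trans _ _ (M / (s / 2))).
    by apply: ler_pM => //; rewrite ?invr_ge0 ?(ltW y00)// lef_pV2 ?posrE ?divr_gt0// ltW.
  rewrite (_ : M / (s / 2) = 2 * (M / s)); last by field; rewrite gt_eqF.
  rewrite /c [leRHS]mulrA ler_pM2r// mulrDr -[2]addr0 lerD ?mulr_ge0//.
  by rewrite -natrM ler_nat.
split.
- exact: le_trans cL.
- by rewrite (axial_eq2 UV)// normrN; exact: le_trans cL.
- exact: le_trans cL.
- have -> : Vy x0 y0 = Ux x0 y0 - 2 * l * (V x0 y0 / y0) by rewrite (axial_eq1 UV)// addrK.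
  rewrite (le_trans (ler_normB _ _))// LE lerD// normrM ger0_norm ?mulr_ge0//.
  by rewrite (_ : 6 * l * c = 2 * l * (3 * c)) ?ler_wpM2l ?mulr_ge0//; ring.
Qed.

End pair.
End axial_pairs.

(** * Comparability of values around a weighted maximum *)

Section dominating_box.
Context {R : realType}.

(** Each point of the half-size box is the centre of a box of size [d / 2] inside the large one,
    which gives the gradient bound [L]. The path goes vertically from [(x1, y1)] to height [y] and
    then horizontally, so it meets the axis at most at its starting point. *)
Lemma axial_box_lipschitz (l : R) D (U Ux Uy V Vx Vy : R -> R -> R)
    (x1 y1 d M x y : R) :
  0 <= l -> axial_pair l D U Ux Uy V Vx Vy ->
  0 < d -> 0 <= y1 -> 0 < M -> 0 < y ->
  (forall x y, `|x - x1| <= d -> `|y - y1| <= d -> 0 <= y ->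
    [/\ D x y, `|U x y| <= M & `|V x y| <= M]) ->
  `|x - x1| <= d / 2 -> `|y - y1| <= d / 2 ->
  let L := (17 + 8 * l) * (1 + 6 * l) * (M / (d / 2)) in
  `|U x y - U x1 y1| <= L * (`|x - x1| + `|y - y1|) /\
  `|V x y - V x1 y1| <= L * (`|x - x1| + `|y - y1|).
Proof.
move=> l0 UV d0 y10 M0 y0 box xx yy L.
have [Uxx [Uxy [Uyy CU]]] := axial_U UV; have [Vxx [Vxy [Vyy CV]]] := axial_V UV.
have d20 : 0 < d / 2 by rewrite divr_gt0.
have d2d : d / 2 <= d by rewrite ger_pMr// invf_le1// ler1n.
have tri (a b c : R) : `|a - b| <= d / 2 -> `|b - c| <= d / 2 -> `|a - c| <= d.
  move=> ab bc; rewrite (_ : a - c = (a - b) + (b - c)); last by ring.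
  by rewrite (le_trans (ler_normD _ _))// [leRHS]splitr lerD.
have grad s t : `|s - x1| <= d / 2 -> `|t - y1| <= d / 2 -> 0 < t ->
    [/\ `|Ux s t| <= L, `|Uy s t| <= L, `|Vx s t| <= L & `|Vy s t| <= L].
  move=> sx ty t0; apply: (axial_gradient l0 UV d20 t0 M0) => x' y' h1 h2 h3.
  by apply: box => //; [exact: tri sx|exact: tri ty].
have inD s t : `|s - x1| <= d / 2 -> `|t - y1| <= d / 2 -> 0 <= t -> D s t.
  by move=> h1 h2 h3; have [] := box s t (le_trans h1 d2d) (le_trans h2 d2d) h3.
have btw (a b v : R) : `|b - a| <= d / 2 -> Num.min a b <= v <= Num.max a b -> `|v - a| <= d / 2.
  by rewrite ge_min le_max !ler_norml => /andP[? ?] /andP[/orP[] ? /orP[] ?]; apply/andP; split; lra.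
have x11 : `|x1 - x1| <= d / 2 by rewrite subrr normr0 ltW.
have L0 : 0 <= L by have [h _ _ _] := grad x y xx yy y0; exact: le_trans h.
have ypos v : Num.min y1 y <= v -> 0 <= v.
  by rewrite ge_min => /orP[]; apply: le_trans => //; exact: ltW.
have ypos' v : Num.min y1 y < v -> 0 < v.
  by rewrite gt_min => /orP[]; [exact: le_lt_trans|exact: lt_trans].
have step (f fx fy : R -> R -> R) :
    (forall x y, D x y -> is_derive x 1 (f ^~ y) (fx x y)) ->
    (forall x y, D x y -> is_derive y 1 (f x) (fy x y)) ->
    (forall s t, `|s - x1| <= d / 2 -> `|t - y1| <= d / 2 -> 0 < t ->
      `|fx s t| <= L /\ `|fy s t| <= L) ->
    `|f x y - f x1 y1| <= L * (`|x - x1| + `|y - y1|).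
  move=> dx dy b.
  rewrite (_ : _ - _ = (f x y - f x1 y) + (f x1 y - f x1 y1)); last by ring.
  rewrite (le_trans (ler_normD _ _))// mulrDr lerD//.
    apply: (@lipschitz_is_derive _ (f ^~ y) (fx ^~ y)) => v.
      by move=> /(btw _ _ _ xx) vx; apply: dx; apply: inD => //; exact: ltW.
    move=> /andP[v1 v2]; apply: (proj1 (b _ _ _ _ _)) => //.
    by apply: (btw _ _ _ xx); rewrite !ltW.
  apply: (@lipschitz_is_derive _ (f x1) (fy x1)) => v.
    move=> vy; apply: dy; apply: inD => //; first exact: (btw _ _ _ yy).
    by move: vy => /andP[/ypos].
  move=> /andP[v1 v2]; apply: (proj2 (b _ _ _ _ _)) => //; last exact: ypos'.
  by apply: (btw _ _ _ yy); rewrite !ltW.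
split; apply: step.
- exact: (C2_x CU).
- exact: (C2_y CU).
- by move=> s t h1 h2 h3; have [] := grad s t h1 h2 h3.
- exact: (C2_x CV).
- exact: (C2_y CV).
- by move=> s t h1 h2 h3; have [] := grad s t h1 h2 h3.
Qed.

(* A gradient bound by the supremum over a larger box forces [|U| + |V|] to be
   comparable to its value on a whole box around the maximum point of
   [dist(z, boundary) ^ m * (|U| + |V|)(z)]; this is what makes every power
   of [|U| + |V|], however small, satisfy a sub-mean-value inequality. *)
Lemma axial_dominating_box (l : R) (m : nat) : 0 <= l -> (0 < m)%N ->
  exists2 e : R, 0 < e <= 1 & forall D (U Ux Uy V Vx Vy : R -> R -> R) (x0 y0 r : R),
  axial_pair l D U Ux Uy V Vx Vy -> 0 < r -> 0 <= y0 ->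
  (forall x y, `|x - x0| <= r -> `|y - y0| <= r -> 0 <= y -> D x y) ->
  let G x y := `|U x y| + `|V x y| in
  0 < G x0 y0 ->
  exists x1 y1 d : R, [/\ 0 < d <= r, 0 <= y1, `|x1 - x0| <= r - d /\ `|y1 - y0| <= r - d,
    r ^+ m * G x0 y0 <= d ^+ m * G x1 y1 &
    forall x y, `|x - x1| <= e * d -> `|y - y1| <= e * d -> 0 < y ->
      G x1 y1 / 2 <= G x y].
Proof.
move=> l0 m0; set C := (17 + 8 * l) * (1 + 6 * l).
have C1 : 1 <= C.
  rewrite -[1]mulr1; apply: ler_pM => //; last by rewrite lerDl mulr_ge0.
  by apply: (@le_trans _ _ 17); [rewrite ler1n|rewrite lerDl mulr_ge0].
have C0 : 0 < C by exact: lt_le_trans C1.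
have m20 : 1 <= 2 ^+ m :> R by rewrite exprn_ege1// ler1n.
have m2p : 0 < 2 ^+ m :> R by rewrite exprn_gt0.
have Cm0 : 0 < 32 * C * 2 ^+ m by apply: mulr_gt0 => //; exact: mulr_gt0.
have e4 : (32 * C * 2 ^+ m)^-1 <= 4^-1.
  rewrite lef_pV2 ?posrE// -[leLHS]mulr1 ler_pM//.
  by rewrite -[leLHS]mulr1 ler_pM// ler_nat.
(* On a box of size [d / 2] the maximality gives [G <= 2 ^ m * G1], with [G1] the value of [G] at
   the maximum, hence a gradient at most [4 * C * 2 ^ m * G1 / d]. A displacement of [e * d] in each
   coordinate then changes [U] and [V] by at most [G1 / 4] each, for this [e]. *)
exists (32 * C * 2 ^+ m)^-1.
  by rewrite invr_gt0 Cm0/= (le_trans e4)// invf_le1// ler1n.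
move=> D U Ux Uy V Vx Vy x0 y0 r UV r0 y00 box G G0.
have [Uxx [Uxy [Uyy CU]]] := axial_U UV; have [Vxx [Vxy [Vyy CV]]] := axial_V UV.
(* This is the sup-norm distance to the boundary of the full box: the face of [K] on the axis does
   not count as boundary, and the maximum may lie on it. *)
pose rho x y := r - Num.max `|x - x0| `|y - y0|.
pose K := `[x0 - r, x0 + r] `*` `[Num.max 0 (y0 - r), y0 + r].
have KP x y : K (x, y) <-> [/\ `|x - x0| <= r, `|y - y0| <= r & 0 <= y].
  rewrite /K /= !in_itv/= ge_max !ler_distl; split.
    by move=> [-> /andP[/andP[-> ->] ->]].
  by move=> [-> /andP[-> ->] ->].
have cK : compact K by apply: compact_setX; exact: segment_compact.
have K0 : K (x0, y0) by apply/KP; rewrite !subrr !normr0; split=> //; exact: ltW.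
have cF : {within K, continuous (fun p => rho p.1 p.2 ^+ m * G p.1 p.2)}.
  apply: continuous_in_subspaceT => -[x y]; rewrite inE => /KP[h1 h2 h3].
  have Dxy : D x y by exact: box.
  have c1 : {for (x, y), continuous (fun p : R * R => p.1)} by exact: cvg_fst.
  have c2 : {for (x, y), continuous (fun p : R * R => p.2)} by exact: cvg_snd.
  have cc (w : R) : {for (x, y), continuous (fun _ : R * R => w)} by exact: cst_continuous.
  have crho : {for (x, y), continuous (fun p => rho p.1 p.2)}.
    apply: (for_continuousB (cc r)).
    have n1 : {for (x, y), continuous (fun p => `|p.1 - x0|)}.
      exact: (cvg_norm (cvgB c1 (cc x0))).
    have n2 : {for (x, y), continuous (fun p => `|p.2 - y0|)}.
      exact: (cvg_norm (cvgB c2 (cc y0))).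
    rewrite (_ : (fun p : R * R => _) = (fun p => (`|p.1 - x0| + `|p.2 - y0| +
        `| `|p.1 - x0| - `|p.2 - y0| |) / 2)); last first.
      by apply/funext => p; rewrite maxr_absE.
    apply: (for_continuousM _ (cc 2^-1)).
    exact: (cvgD (cvgD n1 n2) (cvg_norm (cvgB n1 n2))).
  have crhom : {for (x, y), continuous (fun p => rho p.1 p.2 ^+ m)}.
    by apply: (@continuous_comp _ _ _ (fun p : R * R => rho p.1 p.2) (fun x => x ^+ m) _ crho); exact: exprn_continuous.
  apply: (for_continuousM crhom).
  by apply: for_continuousD; [exact: (cvg_norm (C2_cont CU Dxy))|exact: (cvg_norm (C2_cont CV Dxy))].
have [[x1 y1] /set_mem Kc maxc] := compact_EVT_max (ex_intro _ _ K0) cK cF.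
have {maxc} maxc x y : K (x, y) -> rho x y ^+ m * G x y <= rho x1 y1 ^+ m * G x1 y1.
  by move=> /mem_set /maxc.
have [x1r y1r y10] := (KP _ _).1 Kc.
set d := rho x1 y1 in maxc.
have d_ge0 : 0 <= d by rewrite subr_ge0 ge_max x1r.
have rho0 : rho x0 y0 = r by rewrite /rho !subrr !normr0 maxxx subr0.
have max0 := maxc _ _ K0; rewrite rho0 in max0.
have G_ge0 x y : 0 <= G x y by rewrite addr_ge0.
have pos0 : 0 < r ^+ m * G x0 y0 by rewrite mulr_gt0// exprn_gt0.
have d0 : 0 < d.
  rewrite lt_neqAle d_ge0 andbT; apply/eqP => dE.
  by move: (lt_le_trans pos0 max0); rewrite -dE expr0n gtn_eqF// mul0r ltxx.
have G1 : 0 < G x1 y1.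
  by move: (lt_le_trans pos0 max0); rewrite pmulr_rgt0// exprn_gt0.
exists x1, y1, d; split=> //.
- by rewrite d0/= /d /rho gerBl le_max normr_ge0.
- by rewrite /d /rho opprB [r + _]addrC subrK !le_max !lexx orbT.
move=> x y xx yy y_gt0.
set e := _^-1 in e4 xx yy.
set M := 2 ^+ m * G x1 y1.
have M0 : 0 < M by rewrite mulr_gt0.
have d20 : 0 < d / 2 by rewrite divr_gt0.
have boxd s t : `|s - x1| <= d / 2 -> `|t - y1| <= d / 2 -> 0 <= t ->
    [/\ D s t, `|U s t| <= M & `|V s t| <= M].
  move=> sx ty t0.
  have rhoE : d / 2 <= rho s t.
    rewrite /rho lerBrDr -lerBrDl ge_max.
    have rd z w : `|z - w| <= Num.max `|x1 - x0| `|y1 - y0| -> `|z - w| <= r - d.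
      by rewrite /d /rho opprB [r + _]addrC subrK.
    have half : r - d / 2 = (d / 2) + (r - d) by field.
    rewrite half; apply/andP; split.
      rewrite (_ : s - x0 = (s - x1) + (x1 - x0)); last by ring.
      by rewrite (le_trans (ler_normD _ _))// lerD// rd// le_max lexx.
    rewrite (_ : t - y0 = (t - y1) + (y1 - y0)); last by ring.
    by rewrite (le_trans (ler_normD _ _))// lerD// rd// le_max lexx orbT.
  have Kst : K (s, t).
    apply/KP; have : 0 <= rho s t by apply: le_trans rhoE; exact: ltW.
    by rewrite subr_ge0 ge_max => /andP[].
  have GM : G s t <= M.
    rewrite -(@ler_pM2l _ ((d / 2) ^+ m)) ?exprn_gt0//.
    rewrite /M mulrA -exprMn divfK ?gt_eqF//; apply: le_trans (maxc _ _ Kst).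
    by rewrite ler_wpM2r// lerXn2r ?nnegrE// ltW// (lt_le_trans d20).
  split.
  - by move: Kst => /KP[]; exact: box.
  - by apply: le_trans GM; rewrite lerDl.
  - by apply: le_trans GM; rewrite lerDr.
have ed : e * d <= d / 2 / 2.
  rewrite (_ : d / 2 / 2 = 4^-1 * d); last by field.
  by rewrite ler_pM2r.
have [h1 h2] := axial_box_lipschitz l0 UV d20 y10 M0 y_gt0 boxd (le_trans xx ed) (le_trans yy ed).
rewrite -/C in h1 h2.
have LE : C * (M / (d / 2 / 2)) * (e * d + e * d) = G x1 y1 / 4.
  by rewrite /M /e; field; rewrite ?gt_eqF.
have h3 : C * (M / (d / 2 / 2)) * (`|x - x1| + `|y - y1|) <= G x1 y1 / 4.
  rewrite -LE ler_wpM2l ?lerD// mulr_ge0 ?(ltW C0)// divr_ge0 ?(ltW M0)//.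
  by rewrite !divr_ge0// ltW.
have {}h1 := le_trans h1 h3; have {}h2 := le_trans h2 h3.
have tri (a b c : R) : `|a - b| <= c -> `|b| - c <= `|a|.
  rewrite distrC => abc; rewrite lerBlDr -{1}[b](subrK a) addrC.
  by rewrite (le_trans (ler_normD _ _))// lerD2l.
have := lerD (tri _ _ _ h1) (tri _ _ _ h2).
rewrite addrACA -opprD -/(G x y) -/(G x1 y1); apply: le_trans.
by rewrite le_eqVlt; apply/orP; left; apply/eqP; field.
Qed.

End dominating_box.

(** * The real systems of a lambda-analytic function *)

Section analytic_pairs.
Context {R : realType}.
Implicit Types (D : R -> R -> Prop) (u v : R -> R -> R).

Lemma C2_data_reflect D u ux uy uxx uxy uyy :
  (forall x y, D x y -> D x (- y)) -> C2_data D u ux uy uxx uxy uyy ->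
  C2_data D (fun x y => u x (- y)) (fun x y => ux x (- y)) (fun x y => - uy x (- y))
    (fun x y => uxx x (- y)) (fun x y => - uxy x (- y)) (fun x y => uyy x (- y)).
Proof.
move=> symD C2.
have refl (f : R -> R) (f' y : R) : is_derive (- y) 1 f f' -> is_derive y 1 (fun t => f (- t)) (- f').
  move=> df; have := @is_derive_shiftB _ f 0 y f'; rewrite sub0r => /(_ df).
  by under eq_fun do rewrite sub0r.
split=> x y /symD Dxy.
- exact: (C2_x C2 Dxy).
- by apply: (refl (u x)); exact: (C2_y C2).
- exact: (C2_xx C2 Dxy).
- by apply: (refl (ux x)); exact: (C2_xy C2).
- by apply: is_deriveN; exact: (C2_yx C2).
- by rewrite -[uyy _ _]opprK; apply: is_deriveN; apply: (refl (uy x)); exact: (C2_yy C2).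
- apply: (@for_continuous_pair _ _ fst (fun z : R * R => - z.2) u (x, y)).
  + exact: cvg_fst.
  + by apply: cvgN; exact: cvg_snd.
  + exact: (C2_cont C2 Dxy).
Qed.

Lemma C2_data_lin D (a b : R) u ux uy uxx uxy uyy v vx vy vxx vxy vyy :
  C2_data D u ux uy uxx uxy uyy -> C2_data D v vx vy vxx vxy vyy ->
  C2_data D (fun x y => a * u x y + b * v x y) (fun x y => a * ux x y + b * vx x y)
    (fun x y => a * uy x y + b * vy x y) (fun x y => a * uxx x y + b * vxx x y)
    (fun x y => a * uxy x y + b * vxy x y) (fun x y => a * uyy x y + b * vyy x y).
Proof.
move=> Cu Cv; split=> x y Dxy.
- by apply: is_deriveD; apply: is_deriveZ; [exact: (C2_x Cu)|exact: (C2_x Cv)].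
- by apply: is_deriveD; apply: is_deriveZ; [exact: (C2_y Cu)|exact: (C2_y Cv)].
- by apply: is_deriveD; apply: is_deriveZ; [exact: (C2_xx Cu)|exact: (C2_xx Cv)].
- by apply: is_deriveD; apply: is_deriveZ; [exact: (C2_xy Cu)|exact: (C2_xy Cv)].
- by apply: is_deriveD; apply: is_deriveZ; [exact: (C2_yx Cu)|exact: (C2_yx Cv)].
- by apply: is_deriveD; apply: is_deriveZ; [exact: (C2_yy Cu)|exact: (C2_yy Cv)].
- have cc (w : R) : {for (x, y), continuous (fun _ : R * R => w)} by exact: cst_continuous.
  by apply: for_continuousD; apply: for_continuousM => //;
    [exact: (C2_cont Cu)|exact: (C2_cont Cv)].
Qed.

Lemma C2_data_opp D u ux uy uxx uxy uyy : C2_data D u ux uy uxx uxy uyy ->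
  C2_data D (fun x y => - u x y) (fun x y => - ux x y) (fun x y => - uy x y)
    (fun x y => - uxx x y) (fun x y => - uxy x y) (fun x y => - uyy x y).
Proof.
move=> C2; split=> x y Dxy.
- by apply: is_deriveN; exact: (C2_x C2).
- by apply: is_deriveN; exact: (C2_y C2).
- by apply: is_deriveN; exact: (C2_xx C2).
- by apply: is_deriveN; exact: (C2_xy C2).
- by apply: is_deriveN; exact: (C2_yx C2).
- by apply: is_deriveN; exact: (C2_yy C2).
- by apply: cvgN; exact: (C2_cont C2).
Qed.

Lemma cabsE (x y : R) : cabs (Complex x y) = Num.sqrt (x ^+ 2 + y ^+ 2).
Proof. by []. Qed.

Lemma pdiskE (x y : R) : pdisk R (x, y) <-> x ^+ 2 + y ^+ 2 < 1.
Proof.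
rewrite /pdisk /disk /= /cplx cabsE/=; split.
  by rewrite -[X in _ < X -> _]sqrtr1 ltr_sqrt.
by rewrite -[X in _ -> _ < X]sqrtr1 ltr_sqrt.
Qed.

Lemma pdisk_conj (x y : R) : pdisk R (x, y) -> pdisk R (x, - y).
Proof. by rewrite !pdiskE sqrrN. Qed.

Lemma open_pdisk : open (pdisk R).
Proof.
have -> : pdisk R = (fun z : R * R => z.1 ^+ 2 + z.2 ^+ 2) @^-1` [set t | t < 1].
  by apply/funext => -[x y]; apply/propext; exact: pdiskE.
apply: open_comp; last exact: open_lt.
move=> [x y] _.
apply: (@for_continuousD _ _ (fun z : R * R => z.1 ^+ 2) (fun z : R * R => z.2 ^+ 2)).
  have c1 : {for (x, y), continuous (fun z : R * R => z.1)} by exact: cvg_fst.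
  exact: (for_continuousM c1 c1).
have c2 : {for (x, y), continuous (fun z : R * R => z.2)} by exact: cvg_snd.
exact: (for_continuousM c2 c2).
Qed.

(** The denominator of the quotient is [2 i y], and dividing by [i] exchanges real and imaginary
    parts: [ux - vy] is paired with the odd part of the imaginary part, and [vx + uy] with the odd
    part of the real part. *)
Lemma dunkl_system (l : R) (f : R[i] -> R[i]) (x y : R) :
  lambda_analytic l f -> pdisk R (x, y) -> y != 0 ->
  let ux := 'D_((1, 0) : R * R) (re_part f) (x, y) in
  let uy := 'D_((0, 1) : R * R) (re_part f) (x, y) in
  let vx := 'D_((1, 0) : R * R) (im_part f) (x, y) in
  let vy := 'D_((0, 1) : R * R) (im_part f) (x, y) in
  ux - vy = l * ((im_part f (x, y) - im_part f (x, - y)) / y) /\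
  vx + uy = - (l * ((re_part f (x, y) - re_part f (x, - y)) / y)).
Proof.
move=> [_ _ /(_ (Complex x y))] + Dxy y0 /= => /(_ Dxy).
rewrite /dunkl_dbar /dbar /pderiv /dunkl_quot /= (negPf y0) /conj_quot.
rewrite /re_part /im_part /cplx /=.
set ux := 'D_ _ _ _; set vx := 'D_ _ _ _; set uy := 'D_ _ _ _; set vy := 'D_ _ _ _.
case: (f (Complex x y)) => a b; case: (f (Complex x (- y))) => c d /=.
move/eqP; rewrite subr_eq0 => /eqP E.
have n2 : (2%:R : R[i]) != 0 by rewrite pnatr_eq0.
have wy : (Complex x y - conjc (Complex x y) : R[i]) = Complex 0 (2 * y).
  by simpc; congr (Complex _ _); ring.
have wn0 : (Complex 0 (2 * y) : R[i]) != 0.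
  by rewrite eq_complex/= eqxx/= mulf_neq0// pnatr_eq0.
have {}E : (Complex ux vx + Complex 0 1 * Complex uy vy) * Complex 0 (2 * y) =
    2%:R * (Complex l 0 * (Complex a b - Complex c d)) :> R[i].
  move: E; rewrite wy => /(congr1 (fun w => 2%:R * (w * Complex 0 (2 * y)))).
  rewrite mulrA [2%:R * (_ / _)]mulrC divfK// => ->.
  by rewrite -!mulrA mulVf// mulr1.
have C2 : 2%:R = Complex 2 0 :> R[i].
  by rewrite mulr2n; simpc; rewrite -mulr2n.
move: E; rewrite C2; simpc => -[E1 E2].
split; apply: (mulIf y0).
- by rewrite -mulrA divfK//; apply: (@mulfI _ 2); rewrite ?pnatr_eq0//; move: E2; clear; lra.
- by rewrite mulNr -mulrA divfK//; apply: (@mulfI _ 2); rewrite ?pnatr_eq0//; move: E1; clear; lra.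
Qed.

(** The difference quotients on the right are even in [y], so the system at [(x, y)] and at
    [(x, - y)] has the same right-hand sides and the two copies can be combined. The conditions on
    the axis come from parity alone. Writing [+ - 2^-1 *] matches the form of [C2_data_lin]. *)
Lemma axial_pair_even_odd (l : R) D u ux uy uxx uxy uyy v vx vy vxx vxy vyy :
  (forall x y, D x y ->
    exists2 d : R, 0 < d & forall s t, `|s - x| < d -> `|t - y| < d -> D s t) ->
  (forall x y, D x y -> D x (- y)) ->
  C2_data D u ux uy uxx uxy uyy -> C2_data D v vx vy vxx vxy vyy ->
  (forall x y, D x y -> y != 0 ->
    ux x y - vy x y = l * ((v x y - v x (- y)) / y) /\
    vx x y + uy x y = - (l * ((u x y - u x (- y)) / y))) ->
  axial_pair l D
    (fun x y => 2^-1 * u x y + 2^-1 * u x (- y))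
    (fun x y => 2^-1 * ux x y + 2^-1 * ux x (- y))
    (fun x y => 2^-1 * uy x y + 2^-1 * - uy x (- y))
    (fun x y => 2^-1 * v x y + - 2^-1 * v x (- y))
    (fun x y => 2^-1 * vx x y + - 2^-1 * vx x (- y))
    (fun x y => 2^-1 * vy x y + - 2^-1 * - vy x (- y)).
Proof.
move=> oD symD Cu Cv sys.
have sys2 x y : D x y -> 0 < y ->
    [/\ ux x y - vy x y = l * ((v x y - v x (- y)) / y),
        vx x y + uy x y = - (l * ((u x y - u x (- y)) / y)),
        ux x (- y) - vy x (- y) = l * ((v x y - v x (- y)) / y) &
        vx x (- y) + uy x (- y) = - (l * ((u x y - u x (- y)) / y))].
  move=> Dxy y0; have yn0 : y != 0 by rewrite gt_eqF.
  have [h1 h2] := sys _ _ Dxy yn0.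
  have yNn0 : - y != 0 by rewrite oppr_eq0.
  have [h3 h4] := sys _ _ (symD _ _ Dxy) yNn0.
  by rewrite opprK in h3 h4; split=> //; [rewrite h3|rewrite h4]; field.
split=> //.
- by do 3 eexists; apply: C2_data_lin Cu (C2_data_reflect symD Cu).
- by do 3 eexists; apply: C2_data_lin Cv (C2_data_reflect symD Cv).
- move=> x y Dxy y0; have [h1 _ h3 _] := sys2 _ _ Dxy y0.
  have -> : ux x y = vy x y + l * ((v x y - v x (- y)) / y) by rewrite -h1 addrC subrK.
  have -> : ux x (- y) = vy x (- y) + l * ((v x y - v x (- y)) / y) by rewrite -h3 addrC subrK.
  by field; rewrite gt_eqF.
- move=> x y Dxy y0; have [_ h2 _ h4] := sys2 _ _ Dxy y0.
  have -> : uy x y = - (l * ((u x y - u x (- y)) / y)) - vx x y by rewrite -h2 addrC addKr.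
  have -> : uy x (- y) = - (l * ((u x y - u x (- y)) / y)) - vx x (- y) by rewrite -h4 addrC addKr.
  by field; rewrite gt_eqF.
- by move=> x _; rewrite oppr0; ring.
- by move=> x _; rewrite oppr0; ring.
Qed.

Lemma cabs_le (a b : R) : cabs (Complex a b) <= `|a| + `|b|.
Proof.
rewrite cabsE -[leRHS]ger0_norm ?addr_ge0// -sqrtr_sqr ler_wsqrtr//.
rewrite sqrrD -(real_normK (num_real a)) -(real_normK (num_real b)).
by rewrite addrAC lerDl mulrn_wge0// mulr_ge0.
Qed.

Lemma le_cabs (a b : R) : `|a| <= cabs (Complex a b) /\ `|b| <= cabs (Complex a b).
Proof.
by rewrite cabsE -!sqrtr_sqr; split; rewrite ler_wsqrtr// ?lerDl ?lerDr sqr_ge0.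
Qed.

Lemma cabs_even_odd (a b c d : R) :
  cabs (Complex a b) <=
    `|2^-1 * a + 2^-1 * c| + `|2^-1 * b + - 2^-1 * d| +
    (`|2^-1 * b + 2^-1 * d| + `|2^-1 * (- a) + - 2^-1 * (- c)|).
Proof.
apply: le_trans (cabs_le _ _) _.
have -> : 2^-1 * (- a) + - 2^-1 * (- c) = - (2^-1 * a - 2^-1 * c) by ring.
rewrite normrN addrACA [leRHS]addrA.
rewrite addrAC [X in _ <= X + _]addrC.
have := ler_normD (2^-1 * a + 2^-1 * c) (2^-1 * a - 2^-1 * c).
have := ler_normD (2^-1 * b + - 2^-1 * d) (2^-1 * b + 2^-1 * d).
rewrite (_ : _ + _ = b); last by field.
rewrite (_ : _ + (2^-1 * a - _) = a); last by field.
lra.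
Qed.

Lemma even_odd_cabs (a b c d : R) :
  `|2^-1 * a + 2^-1 * c| + `|2^-1 * b + - 2^-1 * d| <=
    cabs (Complex a b) + cabs (Complex c d) /\
  `|2^-1 * b + 2^-1 * d| + `|2^-1 * (- a) + - 2^-1 * (- c)| <=
    cabs (Complex a b) + cabs (Complex c d).
Proof.
have [a1 b1] := le_cabs a b; have [c1 d1] := le_cabs c d.
have half (s t : R) : `|2^-1 * s + 2^-1 * t| <= 2^-1 * (`|s| + `|t|).
  rewrite -mulrDr normrM gtr0_norm ?invr_gt0// ler_pM2l ?invr_gt0//.
  exact: ler_normD.
have := half a c; have := half b d; have := half b (- d); have := half a (- c).
have -> : 2^-1 * (- a) + - 2^-1 * (- c) = - (2^-1 * a + 2^-1 * - c) by ring.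
rewrite [`|- (2^-1 * a + _)|]normrN mulNr -mulrN !normrN.
by move=> h1 h2 h3 h4; split; lra.
Qed.

(** The second pair is the first construction applied to [- i f], with parts [v] and [- u], which is
    again a solution because the Dunkl equation is complex linear. Both [G1] and [G2] are even in
    [y], so they may be evaluated at [|y|], where the half-plane estimates apply. *)
Lemma lambda_analytic_axial_pairs (l : R) (f : R[i] -> R[i]) :
  lambda_analytic l f -> exists U1 U1x U1y V1 V1x V1y U2 U2x U2y V2 V2x V2y,
  let D x y := pdisk R (x, y) in
  let G1 x y := `|U1 x y| + `|V1 x y| in let G2 x y := `|U2 x y| + `|V2 x y| in
  [/\ axial_pair l D U1 U1x U1y V1 V1x V1y, axial_pair l D U2 U2x U2y V2 V2x V2y,
   forall x y, cabs (f (cplx (x, y))) <= G1 x `|y| + G2 x `|y| &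
   forall x y, G1 x y <= cabs (f (cplx (x, y))) + cabs (f (cplx (x, - y))) /\
               G2 x y <= cabs (f (cplx (x, y))) + cabs (f (cplx (x, - y)))].
Proof.
move=> lf; have [C2u C2v _] := lf.
have oD (x y : R) : pdisk R (x, y) ->
    exists2 d : R, 0 < d & forall s t, `|s - x| < d -> `|t - y| < d -> pdisk R (s, t).
  exact: (open_box open_pdisk).
have sys := @dunkl_system l f _ _ lf.
have Cu := is_C2_on_data open_pdisk C2u; have Cv := is_C2_on_data open_pdisk C2v.
have P1 := axial_pair_even_odd oD (@pdisk_conj) Cu Cv sys.
have CNu := C2_data_opp Cu.
have sys2 x y : pdisk R (x, y) -> y != 0 ->
  'D_((1, 0) : R * R) (im_part f) (x, y) - - 'D_((0, 1) : R * R) (re_part f) (x, y) =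
    l * ((- re_part f (x, y) - - re_part f (x, - y)) / y) /\
  - 'D_((1, 0) : R * R) (re_part f) (x, y) + 'D_((0, 1) : R * R) (im_part f) (x, y) =
    - (l * ((im_part f (x, y) - im_part f (x, - y)) / y)).
  move=> Dxy y0; have [<- h2] := sys x y Dxy y0.
  split; first by rewrite opprK h2 -mulrN -mulNr opprD.
  by rewrite opprB addrC.
have P2 := axial_pair_even_odd oD (@pdisk_conj) Cv CNu sys2.
do 12 eexists; split; [exact: P1|exact: P2| |].
- move=> x y.
  have -> : re_part f = (fun z => complex.Re (f (cplx z))) by [].
  have -> : im_part f = (fun z => complex.Im (f (cplx z))) by [].
  have [y0|y0] := lerP 0 y.
    rewrite ?(ger0_norm y0).
    case: (f (cplx (x, y))) => a b; case: (f (cplx (x, - y))) => c d /=.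
    by apply: cabs_even_odd.
  rewrite ?(ltr0_norm y0) ?opprK.
  case: (f (cplx (x, y))) => a b; case: (f (cplx (x, - y))) => c d /=.
  apply: le_trans (cabs_even_odd a b c d) _; rewrite le_eqVlt; apply/orP; left; apply/eqP.
  congr (_ + _ + (_ + _)).
  - by rewrite addrC.
  - by rewrite -normrN; congr (`|_|); ring.
  - by rewrite addrC.
  - by rewrite -normrN; congr (`|_|); ring.
move=> x y.
have -> : re_part f = (fun z => complex.Re (f (cplx z))) by [].
have -> : im_part f = (fun z => complex.Im (f (cplx z))) by [].
case: (f (cplx (x, y))) => a b; case: (f (cplx (x, - y))) => c d /=.
by apply: even_odd_cabs.
Qed.

End analytic_pairs.

(** * The measure sigma *)

Section plane_measurability.
Context {R : realType}.

(** The sigma-algebra of [plane R] is a product one, not generated by open sets by definition; an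
    open set is the countable union of the rational boxes that it contains. *)
Lemma open_measurable_plane (A : set (R * R)) : open A ->
  measurable (A : set (plane R)).
Proof.
move=> oA.
pose box (q : rat * rat * rat * rat) : set (plane R) :=
  `]ratr q.1.1.1, ratr q.1.1.2[ `*` `]ratr q.1.2, ratr q.2[.
pose F q := if `[< box q `<=` A >] then box q else set0.
have -> : A = \bigcup_q F q.
  apply/seteqP; split=> [[x y] Axy|z [q _]]; last by rewrite /F; case: asboolP => // h /h.
  have [e e0 He] := open_box oA Axy.
  have lt1 w : w - e < w by rewrite gtrDl oppr_lt0.
  have lt2 w : w < w + e by rewrite ltrDl.
  have [a /[!in_itv]/= /andP[a1 a2]] := rat_in_itvoo (lt1 x).
  have [b /[!in_itv]/= /andP[b1 b2]] := rat_in_itvoo (lt2 x).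
  have [c /[!in_itv]/= /andP[c1 c2]] := rat_in_itvoo (lt1 y).
  have [d /[!in_itv]/= /andP[d1 d2]] := rat_in_itvoo (lt2 y).
  exists (a, b, c, d) => //; rewrite /F asboolT.
    by split; rewrite /= in_itv/= ?a2 ?c2.
  move=> [s t] [/=]; rewrite !in_itv/= => /andP[s1 s2] /andP[t1 t2].
  by apply: He; rewrite ltr_distl /= ?(lt_trans a1)// ?(lt_trans c1)//=;
    [exact: lt_trans b2|exact: lt_trans d2].
apply: countable_bigcupT_measurable; first exact: countableP.
by move=> q; rewrite /F; case: asboolP => // _; exact: measurableX.
Qed.

Lemma open_continuous_measurable_plane (D : set (R * R)) (f : R * R -> R) :
  open D -> (forall z, D z -> {for z, continuous f}) ->
  measurable_fun (D : set (plane R)) f.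
Proof.
move=> oD cf; apply: (measurability _ (RGenOInfty.measurableE R)).
move=> /= _ [_ [a ->]] <-; apply: open_measurable_plane.
rewrite openE => z [Dz fz] /=; rewrite /interior.
apply: filterI; first exact: open_nbhs_nbhs.
by apply: (cf z Dz); apply: open_nbhs_nbhs; split.
Qed.

Definition pconj (z : plane R) : plane R := (z.1, - z.2).

Lemma measurable_pconj : measurable_fun setT pconj.
Proof.
apply: measurable_fun_pair; first exact: measurable_fst.
exact: (measurableT_comp _ measurable_snd).
Qed.

Lemma measurable_disk : measurable (pdisk R : set (plane R)).
Proof. exact: (open_measurable_plane open_pdisk). Qed.

End plane_measurability.

Section sigma_properties.
Context {R : realType}.
Variable l : R.
Local Notation mu := (@lebesgue_measure R).

Lemma c_lambda_ge0 : 0 <= c_lambda l.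
Proof.
have G0 (s : R) : 0 <= Gamma s.
  by apply: Rintegral_ge0 => t _; rewrite mulr_ge0 ?powR_ge0 ?expR_ge0.
by rewrite divr_ge0 ?mulr_ge0.
Qed.

Lemma sigma_density_ge0 (z : plane R) : (0 <= sigma_density l z)%E.
Proof. by rewrite lee_fin mulr_ge0 ?powR_ge0// c_lambda_ge0. Qed.

Lemma measurable_sigma_density (A : set (plane R)) :
  measurable_fun A (sigma_density l).
Proof.
apply: (@measurable_funS _ _ _ _ setT) => //.
apply/measurable_EFinP; apply: measurable_funM => //.
apply: (measurableT_comp (measurable_powR _)).
exact: (measurableT_comp (@normr_measurable R setT) measurable_snd).
Qed.

Lemma lebesgue2_rectangle (a b s t : R) : 0 <= s -> 0 <= t ->
  (mu \x mu)%E (`[a, a + s] `*` `[b, b + t] : set (plane R)) = (s * t)%:E.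
Proof.
move=> s0 t0; rewrite product_measure1E//= !lebesgue_measure_itv/= !lte_fin.
have len (u v : R) : 0 <= v ->
    (if u < u + v then ((u + v)%:E - u%:E)%E else 0%E) = v%:E.
  move=> v0; rewrite ltrDl; case: ltP => [_|v0']; first by rewrite -EFinB addrC addKr.
  by have -> : v = 0 by apply/eqP; rewrite eq_le v0 v0'.
by rewrite !len// EFinM.
Qed.

Lemma sigma_rectangle_ge (a b s t : R) : 0 <= l -> 0 <= s -> 0 <= t -> 0 <= b ->
  ((c_lambda l * b `^ (2 * l) * (s * t))%:E <=
     sigma l (`[a, (a + s)%R] `*` `[b, (b + t)%R]))%E.
Proof.
move=> l0 s0 t0 b0; rewrite EFinM -(lebesgue2_rectangle a b s0 t0) -integral_cst; last first.
  exact: measurableX.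
apply: ge0_le_integral => //.
- exact: measurableX.
- by move=> x _; rewrite lee_fin mulr_ge0 ?powR_ge0// c_lambda_ge0.
- exact: measurable_sigma_density.
move=> [x y] [/= _]; rewrite in_itv/= => /andP[by1 _].
rewrite lee_fin ler_wpM2l ?c_lambda_ge0//=.
by rewrite ge0_ler_powR ?mulr_ge0 ?nnegrE// (le_trans by1)// ler_norm.
Qed.

Lemma sigma_finite_sigma : 0 <= l -> sigma_finite setT (sigma l).
Proof.
move=> l0.
pose F n : set (plane R) := `[- n%:R, - n%:R + 2 * n%:R] `*` `[- n%:R, - n%:R + 2 * n%:R].
exists F.
  apply/esym; rewrite -subTset => -[x y] _.
  pose n := Num.trunc (`|x| + `|y|); exists n.+1 => //.
  have nx : `|x| + `|y| <= n.+1%:R by apply/ltW; rewrite truncnS_gt.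
  have e (w : R) : `|w| <= n.+1%:R -> - n.+1%:R <= w <= - n.+1%:R + 2 * n.+1%:R.
    rewrite ler_norml => /andP[-> h]/=; apply: (le_trans h).
    by rewrite mulr2n mulrDl mul1r addKr.
  by split; rewrite /= in_itv/=; apply: e; apply: le_trans nx; rewrite ?lerDl ?lerDr.
move=> n; have mF : measurable (F n) by exact: measurableX.
split=> //; apply: (@le_lt_trans _ _ (\int[(mu \x mu)%E]_(z in F n) cst (c_lambda l * n%:R `^ (2 * l))%:E z)%E).
  apply: ge0_le_integral => //.
  - by move=> x _; exact: sigma_density_ge0.
  - exact: measurable_sigma_density.
  - move=> [x y] [/= _]; rewrite in_itv/= => /andP[h1 h2].
    rewrite lee_fin ler_wpM2l ?c_lambda_ge0//=.
    rewrite ge0_ler_powR ?mulr_ge0 ?nnegrE// ler_norml h1/= (le_trans h2)//.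
    by rewrite mulr2n mulrDl mul1r addKr.
rewrite integral_cst// [X in (_ * X)%E](_ : _ = (2 * n%:R * (2 * n%:R))%:E).
  by rewrite -EFinM ltry.
by apply: lebesgue2_rectangle; rewrite mulr_ge0.
Qed.

(** Slicing by Tonelli reduces this to the invariance of one-dimensional Lebesgue measure under
    [y -> - y], as the density depends on [|y|] only. *)
Lemma sigma_pconj (A : set (plane R)) : measurable A ->
  pushforward (sigma l) pconj A = sigma l A.
Proof.
move=> mA.
have mpre : measurable (@pconj R @^-1` A).
  by rewrite -[X in measurable X]setTI; exact: measurable_pconj.
have E (B : set (plane R)) : measurable B -> sigma l B =
   (\int[mu]_x \int[mu]_y (sigma_density l \_ B) (x, y))%E.
  move=> mB; rewrite /sigma integral_mkcond fubini_tonelli1//.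
    by apply/(measurable_restrictT _ mB); exact: measurable_sigma_density.
  by apply: erestrict_ge0 => z _; exact: sigma_density_ge0.
rewrite /pushforward (E _ mpre) (E _ mA); apply: eq_integral => x _.
have mh : measurable_fun setT (fun y : measurableTypeR R => (sigma_density l \_ A) (x, y)).
  apply: measurableT_comp; last exact: measurable_pair1.
  by apply/(measurable_restrictT _ mA); exact: measurable_sigma_density.
have mN : measurable_fun setT (-%R : measurableTypeR R -> measurableTypeR R) by [].
transitivity (\int[pushforward mu (-%R : measurableTypeR R -> measurableTypeR R)]_y
    (sigma_density l \_ A) (x, y))%E; last first.
  by apply: eq_measure_integral => B mB _; exact: lebesgue_measureN.
have h0 : {in setT, forall y : measurableTypeR R, (0 <= (sigma_density l \_ A) (x, y))%E}.
  by move=> y _; apply: erestrict_ge0 => z _; exact: sigma_density_ge0.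
rewrite (ge0_integral_pushforward mN mu measurableT mh h0).
apply: eq_integral => y _ /=; rewrite !patchE.
have -> : ((x, y) \in @pconj R @^-1` A) = ((x, - y) \in A).
  by apply/idP/idP; rewrite !inE.
by case: ifPn => // _; rewrite /sigma_density/= normrN.
Qed.

Lemma integral_pconj (D : set (plane R)) (h : plane R -> \bar R) :
  measurable D -> measurable_fun D h -> (forall z, D z -> 0 <= h z)%E ->
  (\int[sigma l]_(z in pconj @^-1` D) h (pconj z) = \int[sigma l]_(z in D) h z)%E.
Proof.
move=> mD mh h0.
have {}h0 : {in D, forall z, (0 <= h z)%E} by move=> z; rewrite inE; exact: h0.
rewrite -(ge0_integral_pushforward measurable_pconj (sigma l) mD mh h0).
by apply: eq_measure_integral; [exact: measurable_pconj|move=> mp B mB _; exact: sigma_pconj].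
Qed.

End sigma_properties.

(** * Whitney boxes and the sub-mean-value inequality *)

Section geometry.
Context {R : realType}.
Implicit Types (x y : R) (z w : plane R).

Lemma cabs_triangle (a b : R[i]) : cabs (a + b) <= cabs a + cabs b.
Proof.
have cE (c : R[i]) : (cabs c)%:C%C = `|c| by rewrite /cabs normc_def.
by rewrite -lecR rmorphD/= !cE; exact: ler_normD.
Qed.

Lemma cabs_ge0 (a : R[i]) : 0 <= cabs a.
Proof. by case: a => x y; rewrite cabsE sqrtr_ge0. Qed.

Definition depth (z : plane R) : R := 1 - cabs (cplx z).

Lemma depth_gt0 z : pdisk R z <-> 0 < depth z.
Proof. by rewrite /depth subr_gt0. Qed.

Lemma cabs_abs x y : cabs (cplx (x, `|y|)) = cabs (cplx (x, y)).
Proof. by rewrite /cplx !cabsE/= real_normK ?num_real. Qed.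

Lemma cabs_dist z w : cabs (cplx z) <= cabs (cplx w) + `|z.1 - w.1| + `| `|z.2| - `|w.2| |.
Proof.
case: z w => [x y] [x' y']; rewrite -[cabs (cplx (x, y))]cabs_abs -[cabs (cplx (x', y'))]cabs_abs /=.
have -> : cplx (x, `|y|) = cplx (x', `|y'|) + Complex (x - x') (`|y| - `|y'|).
  by rewrite /cplx/=; simpc; rewrite [x' + _]addrC subrK [`|y'| + _]addrC subrK.
by rewrite -addrA (le_trans (cabs_triangle _ _))// lerD2l cabs_le.
Qed.

(* Symmetric under conjugation of [w], because [|f|^p] alone does not satisfy a
   sub-mean-value inequality: the Dunkl equation couples [f(z)] and [f(zbar)]. *)
Definition whitney (z : plane R) : set (plane R) :=
  [set w | `|w.1 - z.1| <= depth z / 8 /\ `| `|w.2| - `|z.2| | <= depth z / 8].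

(** Two coordinate displacements of [depth z / 8] change the modulus by at most [depth z / 4]. *)
Lemma whitney_depth z w : whitney z w ->
  3 / 4 * depth z <= depth w /\ depth w <= 5 / 4 * depth z.
Proof.
move=> [h1 h2]; have d1 := cabs_dist z w; have d2 := cabs_dist w z.
rewrite [`|z.1 - _|]distrC [`| `|z.2| - _|]distrC in d1.
by rewrite /depth in h1 h2 *; split; lra.
Qed.

Lemma whitney_pdisk z w : pdisk R z -> whitney z w -> pdisk R w.
Proof. by move=> /depth_gt0 z0 /whitney_depth[h _]; apply/depth_gt0; lra. Qed.

Lemma measurable_cabs : measurable_fun setT (fun z : plane R => cabs (cplx z)).
Proof.
rewrite (_ : (fun z => _) = (fun z : plane R => Num.sqrt (z.1 ^+ 2 + z.2 ^+ 2))).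
  apply: (measurableT_comp (continuous_measurable_fun (@sqrt_continuous R))).
  by apply: measurable_funD; apply: measurable_funX.
by apply/funext => -[x y]; rewrite /cplx cabsE.
Qed.

Lemma measurable_depth : measurable_fun setT depth.
Proof. by apply: measurable_funB => //; exact: measurable_cabs. Qed.

(** A boolean function of the pair, so that the relation is jointly measurable and Tonelli applies
    to it. *)
Definition whitneyb (u : plane R * plane R) : bool :=
  (`|u.2.1 - u.1.1| <= depth u.1 / 8) && (`| `|u.2.2| - `|u.1.2| | <= depth u.1 / 8).

Lemma whitneyP z w : reflect (whitney z w) (whitneyb (z, w)).
Proof. exact: andP. Qed.

Lemma measurable_whitneyb : measurable_fun setT whitneyb.
Proof.
have md : measurable_fun setT (fun u : plane R * plane R => depth u.1 / 8).
  apply: measurable_funM => //; apply: measurableT_comp; last exact: measurable_fst.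
  exact: measurable_depth.
have m11 : measurable_fun setT (fun u : plane R * plane R => u.1.1).
  exact: (measurableT_comp measurable_fst measurable_fst).
have m12 : measurable_fun setT (fun u : plane R * plane R => u.1.2).
  exact: (measurableT_comp measurable_snd measurable_fst).
have m21 : measurable_fun setT (fun u : plane R * plane R => u.2.1).
  exact: (measurableT_comp measurable_fst measurable_snd).
have m22 : measurable_fun setT (fun u : plane R * plane R => u.2.2).
  exact: (measurableT_comp measurable_snd measurable_snd).
have mn (f : plane R * plane R -> R) : measurable_fun setT f -> measurable_fun setT (fun u => `|f u|).
  by move=> mf; exact: (measurableT_comp (@normr_measurable R setT) mf).
apply: measurable_and; apply: measurable_fun_ler => //.
  by apply: mn; exact: measurable_funB.
by apply: (mn _); apply: measurable_funB; exact: (mn _).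
Qed.

Lemma measurable_whitney z : measurable (whitney z).
Proof.
have -> : whitney z = (fun w => whitneyb (z, w)) @^-1` [set true].
  by apply/seteqP; split=> w /whitneyP.
rewrite -[X in measurable X]setTI.
exact: (measurableT_comp measurable_whitneyb (measurable_pair1 z)).
Qed.

End geometry.

(** * Sub-mean-value inequality *)

Section submean.
Context {R : realType}.

(** Passing from scale [r] to scale [d] loses the ratio [q = d / r] twice through the area and [2 l]
    times through the density; the factor [q ^ (m p)] from the weighted maximum pays for both once
    [m p >= 2 + 2 l]. The constant [128 / e ^ 2] compares [64 d ^ 2] with the area [(e d) ^ 2 / 2],
    and [18 / e] comes from [9 d + y1 <= (18 / e) (y1 + e d / 2)]. *)
Lemma submean_arith (l p : R) (m : nat) (e d r y0 y1 G0 G1 : R) :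
  0 <= l -> 0 < p -> 2 + 2 * l <= m%:R * p -> 0 < e <= 1 -> 0 < d <= r ->
  0 <= y0 -> 0 <= y1 -> `|y1 - y0| <= r - d -> 0 <= G0 -> 0 <= G1 ->
  r ^+ m * G0 <= d ^+ m * G1 ->
  G0 `^ p * ((8 * r) ^+ 2 * (8 * r + y0) `^ (2 * l)) <=
   2 `^ p * (128 / e ^+ 2) * (18 / e) `^ (2 * l) *
   ((G1 / 2) `^ p * ((y1 + e * d / 2) `^ (2 * l) * (e * d * (e * d / 2)))).
Proof.
move=> l0 p0 mp /andP[e0 e1] /andP[d0 dr] y00 y10 yy G00 G10 GG.
have r0 : 0 < r by exact: lt_le_trans dr.
have l20 : 0 <= 2 * l by rewrite mulr_ge0.
set q := d / r.
have q0 : 0 < q by rewrite divr_gt0.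
have q1 : q <= 1 by rewrite ler_pdivrMr// mul1r.
have GG' : G0 `^ p <= q `^ (m%:R * p) * G1 `^ p.
  rewrite powRrM powR_mulrn ?(ltW q0)// -powRM ?exprn_ge0 ?(ltW q0)//.
  rewrite ge0_ler_powR ?(ltW p0) ?nnegrE ?mulr_ge0 ?exprn_ge0 ?(ltW q0)//.
  by rewrite /q expr_div_n mulrAC ler_pdivlMr ?exprn_gt0// mulrC.
have qp : q `^ (m%:R * p) <= q ^+ 2 * q `^ (2 * l).
  rewrite -powR_mulrn ?(ltW q0)// -powRD; last by rewrite (gt_eqF q0) implybT.
  by apply: ger_powR => //; rewrite q0.
have ed : 0 < y1 + e * d / 2 by rewrite ltr_wpDl// divr_gt0// mulr_gt0.
have key : q * (8 * r + y0) <= 18 / e * (y1 + e * d / 2).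
  have y0le : y0 <= y1 + (r - d) by move: yy; rewrite ler_norml => /andP[]; lra.
  have h1 : q * (8 * r + y0) <= 9 * d + y1.
    have -> : q * (8 * r + y0) = 8 * d + q * y0 by rewrite /q; field; rewrite gt_eqF.
    have h2 : q * y0 <= q * y1 + q * (r - d) by rewrite -mulrDr ler_pM2l.
    have h3 : q * y1 <= y1 by exact: ler_piMl.
    have h4 : q * (r - d) <= d.
      have -> : q * (r - d) = d - q * d by rewrite /q; field; rewrite gt_eqF.
      by rewrite gerBl mulr_ge0// ltW.
    lra.
  apply: (le_trans h1).
  have -> : 18 / e * (y1 + e * d / 2) = 9 * d + 18 / e * y1 by field; rewrite gt_eqF.
  by rewrite lerD2l ler_peMl// ler_pdivlMr// mul1r (le_trans e1)// ler1n.
have key2 : q `^ (2 * l) * (8 * r + y0) `^ (2 * l) <=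
    (18 / e) `^ (2 * l) * (y1 + e * d / 2) `^ (2 * l).
  have h : 0 <= 8 * r + y0 by rewrite addr_ge0// mulr_ge0// ltW.
  rewrite -!powRM ?(ltW q0) ?(ltW ed) ?divr_ge0 ?(ltW e0)//.
  rewrite ge0_ler_powR// nnegrE mulr_ge0 ?(ltW q0) ?(ltW ed) ?divr_ge0 ?(ltW e0)//.
have G1p : G1 `^ p = 2 `^ p * (G1 / 2) `^ p.
  by rewrite -powRM ?divr_ge0// mulrC divfK.
apply: (@le_trans _ _ (q ^+ 2 * q `^ (2 * l) * G1 `^ p * ((8 * r) ^+ 2 * (8 * r + y0) `^ (2 * l)))).
  apply: ler_wpM2r; first by apply: mulr_ge0; [exact: sqr_ge0|exact: powR_ge0].
  by apply: (le_trans GG'); apply: ler_wpM2r => //; exact: powR_ge0.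
rewrite G1p.
have -> : q ^+ 2 * q `^ (2 * l) * (2 `^ p * (G1 / 2) `^ p) * ((8 * r) ^+ 2 * (8 * r + y0) `^ (2 * l))
  = (2 `^ p * (G1 / 2) `^ p * 64 * d ^+ 2) * (q `^ (2 * l) * (8 * r + y0) `^ (2 * l)).
  by rewrite /q; field; rewrite gt_eqF.
have -> : 2 `^ p * (128 / e ^+ 2) * (18 / e) `^ (2 * l) *
   ((G1 / 2) `^ p * ((y1 + e * d / 2) `^ (2 * l) * (e * d * (e * d / 2)))) =
   (2 `^ p * (G1 / 2) `^ p * 64 * d ^+ 2) *
   ((18 / e) `^ (2 * l) * (y1 + e * d / 2) `^ (2 * l)).
  by field; rewrite gt_eqF.
apply: ler_wpM2l => //; do 2 (apply: mulr_ge0; last by rewrite ?sqr_ge0).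
by apply: mulr_ge0; exact: powR_ge0.
Qed.

End submean.

Section lambda_submean.
Context {R : realType}.

Lemma axial_submean (l p : R) : 0 <= l -> 0 < p -> exists2 K : R, 0 < K &
  forall (U Ux Uy V Vx Vy : R -> R -> R) (H : plane R -> R),
  axial_pair l (fun x y => pdisk R (x, y)) U Ux Uy V Vx Vy ->
  measurable_fun (pdisk R : set (plane R)) H ->
  let G x y := `|U x y| + `|V x y| in
  (forall x y, pdisk R (x, y) -> G x y `^ p <= H (x, y)) ->
  forall z : plane R, pdisk R z ->
  ((c_lambda l * (G z.1 `|z.2| `^ p * (depth z ^+ 2 * (depth z + `|z.2|) `^ (2 * l))))%:E
   <= K%:E * \int[sigma l]_(w in whitney z) (H w)%:E)%E.
Proof.
move=> l0 p0.
pose m := (Num.trunc ((2 + 2 * l) / p)).+1.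
have mp : 2 + 2 * l <= m%:R * p by rewrite -ler_pdivrMr// ltW// truncnS_gt.
have [e /andP[e0 e1] dom] := axial_dominating_box l0 (ltn0Sn _ : (0 < m)%N).
exists (2 `^ p * (128 / e ^+ 2) * (18 / e) `^ (2 * l)).
  apply: mulr_gt0; first apply: mulr_gt0; first exact: powR_gt0.
    by rewrite divr_gt0// exprn_gt0.
  by rewrite powR_gt0// divr_gt0.
move=> U Ux Uy V Vx Vy H UV mH G GH [x y] Dz /=.
set K := _ * (18 / e) `^ _.
have Kpos : 0 < K.
  apply: mulr_gt0; first apply: mulr_gt0; first exact: powR_gt0.
    by rewrite divr_gt0// exprn_gt0.
  by rewrite powR_gt0// divr_gt0.
have K0 := ltW Kpos.
have z0 : 0 < depth (x, y) by apply/depth_gt0.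
set r := depth (x, y) / 8.
have r0 : 0 < r by rewrite divr_gt0.
have rE : 8 * r = depth (x, y) by rewrite /r; field.
have H0 w : pdisk R w -> 0 <= H w.
  by case: w => s t Dw; apply: le_trans (GH _ _ Dw); exact: powR_ge0.
have I0 : (0 <= \int[sigma l]_(w in whitney (x, y)) (H w)%:E)%E.
  by apply: integral_ge0 => w /(whitney_pdisk Dz) /H0; rewrite lee_fin.
have G_ge0 s t : 0 <= G s t by rewrite addr_ge0.
have [GE|Gne] := eqVneq (G x `|y|) 0.
  rewrite GE powR0; last by rewrite gt_eqF.
  by rewrite mul0r mulr0 mule_ge0// lee_fin.
have Gpos : 0 < G x `|y| by rewrite lt_neqAle eq_sym Gne G_ge0.
have boxD s t : `|s - x| <= r -> `|t - `|y| | <= r -> 0 <= t -> pdisk R (s, t).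
  by move=> h1 h2 t0; apply: (whitney_pdisk Dz); split=> //=; rewrite (ger0_norm t0).
have [x1 [y1 [d [/andP[d0 dr] y10 [x1d y1d] GG lower]]]] :=
  dom _ _ _ _ _ _ _ _ _ _ UV r0 (normr_ge0 y) boxD Gpos.
have ed : 0 < e * d by rewrite mulr_gt0.
have edd : e * d <= d by rewrite ger_pMl.
(* The lower edge is raised by [e * d / 2] so that the density of [sigma] is bounded below on [P]
   even when [y1 = 0]. *)
set P : set (plane R) := `[x1, x1 + e * d] `*` `[y1 + e * d / 2, y1 + e * d / 2 + e * d / 2].
have b0 : 0 < y1 + e * d / 2 by rewrite ltr_wpDl// divr_gt0.
have PE s t : P (s, t) -> [/\ `|s - x1| <= e * d, `|t - y1| <= e * d & 0 < t].
  move=> [/=]; rewrite !in_itv/= => /andP[s1 s2] /andP[t1 t2].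
  split; last exact: lt_le_trans t1.
    by rewrite ger0_norm ?subr_ge0// lerBlDl.
  rewrite ger0_norm ?subr_ge0 ?lerBlDl; last by rewrite (le_trans _ t1)// lerDl divr_ge0// ltW.
  by rewrite (le_trans t2)// -addrA -splitr.
have PW : P `<=` whitney (x, y).
  move=> [s t] /PE[s1 t1 t0]; split=> /=; rewrite -/r.
    rewrite (_ : s - x = (s - x1) + (x1 - x)); last by ring.
    by rewrite (le_trans (ler_normD _ _))// (le_trans (lerD (le_trans s1 edd) x1d))// addrC subrK.
  rewrite (gtr0_norm t0) (_ : t - `|y| = (t - y1) + (y1 - `|y|)); last by ring.
  by rewrite (le_trans (ler_normD _ _))// (le_trans (lerD (le_trans t1 edd) y1d))// addrC subrK.
have mP : measurable P by exact: measurableX.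
have WD : whitney (x, y) `<=` pdisk R by move=> w; exact: whitney_pdisk.
have mHW : measurable_fun (whitney (x, y)) (fun w => (H w)%:E).
  by apply/measurable_EFinP; apply: measurable_funS mH => //; exact: measurable_disk.
have step : (((G x1 y1 / 2) `^ p * (c_lambda l * (y1 + e * d / 2) `^ (2 * l) * (e * d * (e * d / 2))))%:E
    <= \int[sigma l]_(w in whitney (x, y)) (H w)%:E)%E.
  apply: (@le_trans _ _ (\int[sigma l]_(w in P) (H w)%:E)%E); last first.
    apply: ge0_subset_integral => //; first exact: measurable_whitney.
    by move=> w /WD /H0; rewrite lee_fin.
  apply: (@le_trans _ _ (\int[sigma l]_(w in P) (cst ((G x1 y1 / 2) `^ p)%:E w))%E).
    rewrite integral_cst// EFinM; apply: lee_pmul => //.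
    - by rewrite lee_fin powR_ge0.
    - rewrite lee_fin; apply: mulr_ge0.
        by apply: mulr_ge0; [exact: c_lambda_ge0|exact: powR_ge0].
      by apply: mulr_ge0; [exact: ltW|rewrite divr_ge0// ltW].
    - by apply: sigma_rectangle_ge => //; rewrite ?divr_ge0 ?(ltW ed) ?(ltW b0).
  apply: ge0_le_integral => //.
  - by move=> w _; rewrite lee_fin powR_ge0.
  - by apply: measurable_funS mHW => //; exact: measurable_whitney.
  move=> [s t] Pw; have [s1 t1 t0] := PE _ _ Pw.
  rewrite lee_fin; apply: le_trans (GH _ _ (WD _ (PW _ Pw))).
  rewrite ge0_ler_powR ?(ltW p0) ?nnegrE ?divr_ge0//.
  exact: lower.
apply: (@le_trans _ _ (K%:E * ((G x1 y1 / 2) `^ p * (c_lambda l * (y1 + e * d / 2) `^ (2 * l) * (e * d * (e * d / 2))))%:E)%E).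
  rewrite -EFinM lee_fin -rE.
  rewrite (_ : K * _ = c_lambda l * (K * ((G x1 y1 / 2) `^ p * ((y1 + e * d / 2) `^ (2 * l) * (e * d * (e * d / 2)))))); last by ring.
  rewrite ler_wpM2l ?c_lambda_ge0//.
  by apply: (submean_arith l0 p0 mp (m := m) (r := r)) => //; rewrite ?e0 ?d0.
by rewrite lee_pmul2l.
Qed.

Lemma powRD_le (a b p : R) : 0 < p -> 0 <= a -> 0 <= b ->
  (a + b) `^ p <= 2 `^ p * (a `^ p + b `^ p).
Proof.
move=> p0 a0 b0; have [ab|/ltW ba] := leP a b.
  apply: (@le_trans _ _ ((2 * b) `^ p)).
    by rewrite ge0_ler_powR ?(ltW p0) ?nnegrE ?addr_ge0 ?mulr_ge0// mulr2n mulrDl mul1r lerD2r.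
  by rewrite powRM// ler_wpM2l ?powR_ge0// lerDr powR_ge0.
apply: (@le_trans _ _ ((2 * a) `^ p)).
  by rewrite ge0_ler_powR ?(ltW p0) ?nnegrE ?addr_ge0 ?mulr_ge0// mulr2n mulrDl mul1r lerD2l.
by rewrite powRM// ler_wpM2l ?powR_ge0// lerDl powR_ge0.
Qed.

Lemma lambda_analytic_measurable (l : R) (f : R[i] -> R[i]) :
  lambda_analytic l f -> disk_measurable_fun f.
Proof.
move=> [[C1u _ _] [C1v _ _] _]; split; apply: open_continuous_measurable_plane.
- exact: open_pdisk.
- by move=> z; exact: (is_C1_on_continuous open_pdisk C1u).
- exact: open_pdisk.
- by move=> z; exact: (is_C1_on_continuous open_pdisk C1v).
Qed.

Lemma measurable_cabs_powR (f : R[i] -> R[i]) (p : R) : disk_measurable_fun f ->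
  measurable_fun (pdisk R : set (plane R)) (fun w : plane R => cabs (f (cplx w)) `^ p).
Proof.
move=> [mu mv]; apply: (measurableT_comp (measurable_powR _)).
rewrite (_ : (fun w => _) = (fun w : plane R => Num.sqrt (re_part f w ^+ 2 + im_part f w ^+ 2))).
  apply: (measurableT_comp (continuous_measurable_fun (@sqrt_continuous R))).
  by apply: measurable_funD; apply: measurable_funX.
by apply/funext => w; rewrite /re_part /im_part; case: (f _) => a b; rewrite cabsE.
Qed.

Lemma measurable_cabs_powR_pconj (f : R[i] -> R[i]) (p : R) : disk_measurable_fun f ->
  measurable_fun (pdisk R : set (plane R)) (fun w : plane R => cabs (f (cplx (pconj w))) `^ p).
Proof.
move=> mf; have := measurable_cabs_powR p mf.
move=> /(measurable_comp measurable_disk); apply.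
- by move=> _ [[x y] Dw <-]; exact: pdisk_conj.
- by apply: (@measurable_funS _ _ _ _ setT) => //; exact: measurable_pconj.
Qed.

Lemma lambda_submean (l p : R) : 0 <= l -> 0 < p -> exists2 K : R, 0 < K &
  forall f : R[i] -> R[i], lambda_analytic l f ->
  forall z : plane R, pdisk R z ->
  ((c_lambda l * (cabs (f (cplx z)) `^ p * (depth z ^+ 2 * (depth z + `|z.2|) `^ (2 * l))))%:E
   <= K%:E * \int[sigma l]_(w in whitney z)
       (cabs (f (cplx w)) `^ p + cabs (f (cplx (pconj w))) `^ p)%:E)%E.
Proof.
move=> l0 p0; have [K K0 HK] := axial_submean l0 p0.
(* One factor [2 ^ p] comes from [|f| <= G1 + G2], the other from bounding each of [G1], [G2] by the
   moduli of [f] at the point and at its conjugate; [K] occurs once per pair. *)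
exists (2 `^ p * (K * 2 `^ p + K * 2 `^ p)).
  by rewrite !(mulr_gt0, addr_gt0) ?powR_gt0.
move=> f lf z Dz.
have mf := lambda_analytic_measurable lf.
have [U1 [U1x [U1y [V1 [V1x [V1y [U2 [U2x [U2y [V2 [V2x [V2y]]]]]]]]]]]] :=
  lambda_analytic_axial_pairs lf.
move=> [P1 P2 fG Gf].
pose h w := cabs (f (cplx w)) `^ p + cabs (f (cplx (pconj w))) `^ p : R.
have h0 w : 0 <= h w by rewrite addr_ge0 ?powR_ge0.
have mh : measurable_fun (pdisk R : set (plane R)) h.
  by apply: measurable_funD; [exact: measurable_cabs_powR|exact: measurable_cabs_powR_pconj].
have mH : measurable_fun (pdisk R : set (plane R)) (fun w => 2 `^ p * h w).
  by apply: measurable_funM.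
have bnd (G x y : R) : 0 <= G -> G <= cabs (f (cplx (x, y))) + cabs (f (cplx (x, - y))) ->
    G `^ p <= 2 `^ p * h (x, y).
  move=> G0 HG; apply: le_trans (powRD_le p0 (cabs_ge0 _) (cabs_ge0 _)).
  by rewrite ge0_ler_powR ?(ltW p0) ?nnegrE ?addr_ge0 ?cabs_ge0.
have H1 := HK _ _ _ _ _ _ _ P1 mH (fun x y _ => bnd _ x y (addr_ge0 (normr_ge0 _) (normr_ge0 _)) (proj1 (Gf x y))) z Dz.
have H2 := HK _ _ _ _ _ _ _ P2 mH (fun x y _ => bnd _ x y (addr_ge0 (normr_ge0 _) (normr_ge0 _)) (proj2 (Gf x y))) z Dz.
have WD : whitney z `<=` pdisk R by move=> w; exact: whitney_pdisk.
have IE : (\int[sigma l]_(w in whitney z) (2 `^ p * h w)%:E =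
    (2 `^ p)%:E * \int[sigma l]_(w in whitney z) (h w)%:E)%E.
  under eq_integral do rewrite EFinM.
  rewrite ge0_integralZl_EFin ?powR_ge0//; first exact: measurable_whitney.
  - by move=> w _; rewrite lee_fin.
  - by apply/measurable_EFinP; apply: measurable_funS mh => //; exact: measurable_disk.
rewrite IE muleA -EFinM in H1; rewrite IE muleA -EFinM in H2.
have I0 : (0 <= \int[sigma l]_(w in whitney z) (h w)%:E)%E.
  by apply: integral_ge0 => w _; rewrite lee_fin.
set I := (\int[_]_(_ in _) _)%E in I0 H1 H2 *.
rewrite [X in (_ <= X)%E](_ : _ = ((2 `^ p)%:E * ((K * 2 `^ p)%:E * I + (K * 2 `^ p)%:E * I))%E); last first.
  by rewrite EFinM -muleA EFinD ge0_muleDl// lee_fin mulr_ge0 ?powR_ge0// ltW.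
apply: (@le_trans _ _ ((2 `^ p)%:E * _)%E); last first.
  by apply: lee_wpmul2l; [rewrite lee_fin powR_ge0|exact: leeD H1 H2].
rewrite -EFinD -EFinM lee_fin -mulrDr [leRHS]mulrCA ler_wpM2l ?c_lambda_ge0//.
rewrite -mulrDl [leRHS]mulrA ler_wpM2r//.
  by rewrite mulr_ge0 ?sqr_ge0 ?powR_ge0.
apply: le_trans (powRD_le p0 _ _); rewrite ?addr_ge0//.
rewrite ge0_ler_powR ?(ltW p0) ?nnegrE ?addr_ge0 ?cabs_ge0//.
by case: (z) => x y; exact: fG.
Qed.

End lambda_submean.

(** * Carleson measures *)

Section carleson.
Context {R : realType}.
Implicit Types (z w : plane R).

(** The exponent may be negative, as [a - 1] is for [a < 1], hence the two-sided comparison of [s]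
    and [t]. *)
Lemma powR_ratio (s t b : R) : 0 < s -> 0 < t -> s <= 2 * t -> t <= 2 * s ->
  s `^ b <= 2 `^ `|b| * t `^ b.
Proof.
move=> s0 t0 st ts; have [b0|b0] := leP 0 b.
  by rewrite ger0_norm// -powRM ?(ltW t0)// ge0_ler_powR ?nnegrE ?(ltW s0) ?mulr_ge0 ?(ltW t0).
rewrite ltr0_norm// -[b in s `^ b]opprK -[b in t `^ b]opprK (powRN s) (powRN t).
rewrite ler_pdivlMr ?powR_gt0// mulrC ler_pdivrMr ?powR_gt0// -powRM ?(ltW s0)//.
by rewrite ge0_ler_powR ?nnegrE ?(ltW t0) ?mulr_ge0 ?(ltW s0)// oppr_ge0 ltW.
Qed.

(** For [a = 2] this is the order of magnitude of the [sigma]-measure of the Whitney box of [z];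
    each further power of [depth] in the measure raises [a] by one. *)
Definition weight (l a : R) z : R := depth z `^ a * (depth z + `|z.2|) `^ (2 * l).

Lemma weight_gt0 l a z : pdisk R z -> 0 < weight l a z.
Proof.
by move=> /depth_gt0 z0; rewrite mulr_gt0 ?powR_gt0// ltr_wpDr.
Qed.

Lemma measurable_weight l a : measurable_fun setT (weight l a).
Proof.
apply: measurable_funM; apply: (measurableT_comp (measurable_powR _)).
  exact: measurable_depth.
apply: measurable_funD; first exact: measurable_depth.
exact: (measurableT_comp (@normr_measurable R setT) measurable_snd).
Qed.

Lemma weight_whitney l a z w : 0 <= l -> 0 <= a -> pdisk R z -> whitney z w ->
  weight l a w <= 2 `^ (a + 2 * l) * weight l a z.
Proof.
move=> l0 a0 Dz zw; have w0 := (depth_gt0 _).1 (whitney_pdisk Dz zw).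
have z0 := (depth_gt0 _).1 Dz; have [_ h2] := whitney_depth zw.
have dwz : depth w <= 2 * depth z by lra.
have yw : depth w + `|w.2| <= 2 * (depth z + `|z.2|).
  move: zw => [_]; rewrite ler_norml => /andP[_ h].
  have := normr_ge0 z.2; lra.
have l20 : 0 <= 2 * l by rewrite mulr_ge0.
have dy (v : plane R) : 0 < depth v -> 0 <= depth v + `|v.2| by move=> /ltW ?; rewrite addr_ge0.
rewrite /weight powRD; last by rewrite pnatr_eq0 implybT.
rewrite mulrACA -!powRM ?(dy z)// ?(ltW z0)//.
apply: ler_pM; rewrite ?powR_ge0//.
  by apply: ge0_ler_powR; rewrite // nnegrE ?mulr_ge0 // ltW.
by apply: ge0_ler_powR; rewrite // nnegrE ?mulr_ge0 // dy.
Qed.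

Lemma polar (a b : R) : a ^+ 2 + b ^+ 2 = 1 ->
  exists2 t : R, 0 <= t < 2 * pi & cos t = a /\ sin t = b.
Proof.
move=> ab; have a1 : -1 <= a <= 1.
  rewrite -ler_norml -sqrtr_sqr -[leRHS]sqrtr1 ler_wsqrtr//.
  by rewrite -ab lerDl sqr_ge0.
have ca : cos (acos a) = a by apply: acosK; rewrite in_itv.
have sa : sin (acos a) = `|b|.
  by rewrite sin_acos// -ab addrC addKr sqrtr_sqr.
have p0 := pi_gt0 R.
have [b0|b0] := leP 0 b.
  exists (acos a); last by rewrite ca sa ger0_norm.
  by rewrite acos_ge0//= (le_lt_trans (acos_lepi a1))// ltr_pMl// ltr1n.
exists (- acos a + pi *+ 2); last by rewrite cosD2pi sinD2pi cosN sinN ca sa ltr0_norm// opprK.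
(* For [a = 1] the angle would be [2 * pi], outside the half-open range; [b < 0] rules this out. *)
have aN1 : a < 1.
  rewrite lt_neqAle (andP a1).2 andbT; apply/eqP => a_1.
  move: ab; rewrite a_1 expr1n -[RHS]addr0 => /addrI /eqP.
  by rewrite sqrf_eq0 lt_eqF.
have ac0 : 0 < acos a by apply: acos_gt0; rewrite (andP a1).1.
have acp := acos_lepi a1.
by rewrite -mulr_natl; apply/andP; split; lra.
Qed.

Lemma polar_disk w : exists2 t : R, 0 <= t < 2 * pi &
  w.1 = cabs (cplx w) * cos t /\ w.2 = cabs (cplx w) * sin t.
Proof.
case: w => x y /=; set r := cabs _.
have r2 : r ^+ 2 = x ^+ 2 + y ^+ 2.
  by rewrite /r /cplx cabsE/= sqr_sqrtr// addr_ge0 ?sqr_ge0.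
have [r0|r0] := eqVneq r 0.
  exists 0; first by rewrite lexx mulr_gt0// pi_gt0.
  move: r2; rewrite r0 expr0n/= => /esym/eqP.
  by rewrite paddr_eq0 ?sqr_ge0// !sqrf_eq0 => /andP[/eqP -> /eqP ->]; rewrite !mul0r.
have [|t t2 [ct st]] := @polar (x / r) (y / r).
  by rewrite !expr_div_n -mulrDl -r2 divff// expf_neq0.
by exists t => //; rewrite ct st ![r * _]mulrC !divfK.
Qed.

Lemma measurable_carleson_box (t h : R) : measurable (carleson_box t h : set (plane R)).
Proof.
have mf : measurable_fun setT (fun z : plane R =>
    Num.sqrt ((z.1 - cos t) ^+ 2 + (z.2 - sin t) ^+ 2)).
  apply: (measurableT_comp (continuous_measurable_fun (@sqrt_continuous R))).
  by apply: measurable_funD; apply: measurable_funX; apply: measurable_funB.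
pose b z := Num.sqrt ((z.1 - cos t) ^+ 2 + (z.2 - sin t) ^+ 2) <= 2 * h.
have -> : carleson_box t h = pdisk R `&` b @^-1` [set true].
  have E z : cabs (cplx z - (cos t +i* sin t)%C) =
      Num.sqrt ((z.1 - cos t) ^+ 2 + (z.2 - sin t) ^+ 2).
    by rewrite -cabsE; congr cabs; rewrite /cplx; simpc.
  by apply/funext => z; apply/propext; rewrite /carleson_box /setI /preimage /mkset /b -E;
    split=> -[].
apply: measurableI; first exact: measurable_disk.
by rewrite -[X in measurable X]setTI; apply: measurable_fun_ler.
Qed.

(** The box is centred at the radial projection of [w]: [z] is within [depth z / 4 <= depth w / 3]
    of [w], and [w] within [depth w] of the circle. The sum [4 / 3 * depth w] is twice the height
    [2 / 3 * depth w], which also stays below 1. *)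
Lemma whitney_carleson_box z w (t : R) : pdisk R z ->
  `|w.1 - z.1| <= depth z / 8 -> `|w.2 - z.2| <= depth z / 8 -> 3 / 4 * depth z <= depth w ->
  w.1 = cabs (cplx w) * cos t -> w.2 = cabs (cplx w) * sin t ->
  carleson_box t (2 / 3 * depth w) z.
Proof.
move=> Dz h1 h2 h3 wc ws; split=> //.
have -> : cplx z - (cos t +i* sin t)%C =
  Complex (z.1 - w.1) (z.2 - w.2) + Complex (w.1 - cos t) (w.2 - sin t).
  by rewrite /cplx; simpc; congr Complex; ring.
have := cabs_triangle (Complex (z.1 - w.1) (z.2 - w.2)) (Complex (w.1 - cos t) (w.2 - sin t)).
have := cabs_le (z.1 - w.1) (z.2 - w.2); rewrite [`|z.1 - _|]distrC [`|z.2 - _|]distrC.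
have -> : cabs (Complex (w.1 - cos t) (w.2 - sin t)) = `|cabs (cplx w) - 1|.
  rewrite cabsE wc ws -sqrtr_sqr; congr Num.sqrt.
  set r := cabs _; by rewrite -[RHS]mulr1 -[X in _ = _ * X](cos2Dsin2 t); ring.
have : `|cabs (cplx w) - 1| = depth w.
  rewrite distrC ger0_norm//; have := (depth_gt0 _).1 Dz; rewrite /depth in h3 *; lra.
move=> ->; lra.
Qed.

(** With [r] the modulus of [w], [|sin t| <= 2 r |sin t| = 2 |w.2|] when [r > 1 / 2]; otherwise
    [depth w >= 1 / 2] absorbs [|sin t| <= 1]. *)
Lemma carleson_scale w (t : R) : pdisk R w -> w.2 = cabs (cplx w) * sin t ->
  2 / 3 * depth w + `|sin t| <= 4 * (depth w + `|w.2|).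
Proof.
move=> /depth_gt0; rewrite /depth; set r := cabs _ => r1 ->.
have r0 : 0 <= r by exact: cabs_ge0.
rewrite normrM (ger0_norm r0); have := normr_ge0 (sin t).
have : `|sin t| <= 1 by rewrite ler_norml sin_geN1 sin_le1.
move: `|sin t| => s s1 s0.
have [rl|rg] := leP r 2^-1.
  have : 0 <= r * s by rewrite mulr_ge0.
  lra.
have : s <= 2 * (r * s) by rewrite mulrA ler_peMl//; lra.
have : 0 <= r * s by rewrite mulr_ge0.
lra.
Qed.

End carleson.

Section shadow.
Context {R : realType}.
Implicit Types (z w : plane R).

(** Sigma-finiteness of [sigma l] was proved under [0 <= l], so the structure is packed inside the
    proof rather than declared as an instance. *)
Lemma sigma_tonelli (l : R) (F : plane R * plane R -> \bar R) : 0 <= l ->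
  measurable_fun setT F -> (forall u, 0 <= F u)%E ->
  [/\ (\int[sigma l]_z \int[sigma l]_w F (z, w) = \int[sigma l]_w \int[sigma l]_z F (z, w))%E,
    measurable_fun setT (fun z => \int[sigma l]_w F (z, w))%E &
    measurable_fun setT (fun w => \int[sigma l]_z F (z, w))%E].
Proof.
move=> l0 mF F0.
pose H := Measure_isSigmaFinite.Build _ _ _ (sigma l) (sigma_finite_sigma l0).
pose s : {sigma_finite_measure set (plane R) -> \bar R} := HB.pack (sigma l) H.
split.
- exact: (@fubini_tonelli _ _ _ _ _ s s).
- exact: (@measurable_fun_fubini_tonelli_F _ _ _ _ _ s).
- exact: (@measurable_fun_fubini_tonelli_G _ _ _ _ _ s).
Qed.

Definition shadow w : set (plane R) := [set z | pdisk R z /\ whitney z w].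

Lemma measurable_shadow w : measurable (shadow w).
Proof.
have -> : shadow w = pdisk R `&` (fun z => whitneyb (z, w)) @^-1` [set true].
  by apply/seteqP; split=> z [Dz /whitneyP].
apply: measurableI; first exact: measurable_disk.
rewrite -[X in measurable X]setTI.
exact: (measurableT_comp measurable_whitneyb (measurable_pair2 w)).
Qed.

(** The Whitney relation sees only [|y|], so [z] is close to [w] or to its conjugate; each case has
    its own box. *)
Lemma shadow_carleson_boxes w : pdisk R w -> exists t1 t2 : R,
  [/\ 0 <= t1 < 2 * pi, 0 <= t2 < 2 * pi,
   2 / 3 * depth w + `|sin t1| <= 4 * (depth w + `|w.2|),
   2 / 3 * depth w + `|sin t2| <= 4 * (depth w + `|w.2|) &
   shadow w `<=` carleson_box t1 (2 / 3 * depth w) `|` carleson_box t2 (2 / 3 * depth w)].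
Proof.
move=> Dw; have Dw' : pdisk R (pconj w) by case: (w) Dw => x y; exact: pdisk_conj.
have dw' : depth (pconj w) = depth w.
  by rewrite /depth; case: (w) => x y; rewrite /pconj /cplx !cabsE/= sqrrN.
have [t1 t1p [c1 s1]] := polar_disk w; have [t2 t2p [c2 s2]] := polar_disk (pconj w).
exists t1, t2; split=> //; first exact: carleson_scale s1.
  by have := carleson_scale Dw' s2; rewrite dw' /pconj/= normrN.
move=> z [Dz zw]; have [h3 _] := whitney_depth zw; move: zw => [h1 h2].
have [yy|yy] : `|w.2 - z.2| <= depth z / 8 \/ `|- w.2 - z.2| <= depth z / 8.
  have [w0|w0] := leP 0 w.2; have [z0|z0] := leP 0 z.2; move: h2;
    rewrite ?(ger0_norm w0) ?(ger0_norm z0) ?(ltr0_norm w0) ?(ltr0_norm z0).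
  - by left.
  - by rewrite opprK -normrN opprD; right.
  - by right.
  - by rewrite opprK -normrN opprD opprK; left.
- by left; exact: (whitney_carleson_box Dz h1 yy h3 c1 s1).
- right; rewrite -dw'.
  by apply: (whitney_carleson_box Dz _ _ _ c2 s2) => //; rewrite dw'.
Qed.

(** The box height is at most [depth w], and [4 ^ (2 l q)] comes from comparing [h + |sin t|] with
    [depth w + |w.2|]; the Carleson bound then has exactly the exponents of [weight l a w ^ q]. *)
Lemma mu_g_shadow (l p q a C : R) (g : R[i] -> R[i]) :
  0 <= l -> 0 <= q -> 0 <= a -> lambda_analytic l g ->
  (forall t h : R, 0 <= t < 2 * pi -> 0 < h < 1 ->
    (mu_g l p g (carleson_box t h) <=
      (C * ((h + `|sin t|) `^ (2 * (l * q)) * h `^ (a * q)))%:E)%E) ->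
  forall w, pdisk R w ->
  (mu_g l p g (shadow w) <= (2 * (`|C| * 4 `^ (2 * (l * q))) * weight l a w `^ q)%:E)%E.
Proof.
move=> l0 q0 a0 lg HC w Dw.
have [t1 [t2 [t1p t2p s1 s2 sub]]] := shadow_carleson_boxes Dw.
set h := 2 / 3 * depth w in s1 s2 sub.
have d0 := (depth_gt0 w).1 Dw.
have d1 : depth w <= 1 by rewrite /depth gerBl cabs_ge0.
have h01 : 0 < h < 1 by apply/andP; rewrite /h; split; lra.
have hd : h <= depth w by rewrite /h; lra.
have [h0 _] := andP h01.
have dy0 : 0 <= depth w + `|w.2| by rewrite addr_ge0// ltW.
have lq0 : 0 <= 2 * (l * q) by rewrite !mulr_ge0.
have bound t : 0 <= t < 2 * pi -> h + `|sin t| <= 4 * (depth w + `|w.2|) ->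
    (mu_g l p g (carleson_box t h) <= (`|C| * 4 `^ (2 * (l * q)) * weight l a w `^ q)%:E)%E.
  move=> tp st; apply: (le_trans (HC t h tp h01)); rewrite lee_fin.
  apply: (@le_trans _ _ (`|C| * ((h + `|sin t|) `^ (2 * (l * q)) * h `^ (a * q)))).
    by rewrite ler_wpM2r ?mulr_ge0 ?powR_ge0// ler_norm.
  rewrite -mulrA ler_wpM2l//.
  have -> : weight l a w `^ q = depth w `^ (a * q) * (depth w + `|w.2|) `^ (2 * (l * q)).
    by rewrite /weight powRM ?powR_ge0// -!powRrM mulrA.
  rewrite (mulrCA (4 `^ _)) -powRM// mulrC; apply: ler_pM; rewrite ?powR_ge0//.
    by apply: ge0_ler_powR; rewrite ?nnegrE ?(ltW h0) ?(ltW d0)// mulr_ge0.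
  by apply: ge0_ler_powR; rewrite // nnegrE ?(addr_ge0 (ltW h0))// mulr_ge0.
have mg := measurable_cabs_powR p (lambda_analytic_measurable lg).
have gm (B : set (plane R)) : B `<=` pdisk R -> measurable B ->
    measurable_fun B (fun z : plane R => (cabs (g (cplx z)) `^ p)%:E).
  move=> BD mB; apply/measurable_EFinP; apply: measurable_funS mg => //.
  exact: measurable_disk.
have g0 (z : plane R) : (0 <= (cabs (g (cplx z)) `^ p)%:E)%E by rewrite lee_fin powR_ge0.
have mono (A B : set (plane R)) : measurable A -> measurable B -> B `<=` pdisk R ->
    A `<=` B -> (mu_g l p g A <= mu_g l p g B)%E.
  by move=> mA mB BD AB; apply: ge0_subset_integral => //; exact: gm.
set B1 := carleson_box t1 h in sub *; set B2 := carleson_box t2 h in sub *.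
have mB1 : measurable (B1 : set (plane R)) by exact: measurable_carleson_box.
have mB2 : measurable (B2 : set (plane R)) by exact: measurable_carleson_box.
have mD : measurable (B2 `\` B1 : set (plane R)) by exact: measurableD.
have B1D : B1 `<=` pdisk R by move=> z [].
have B2D : B2 `<=` pdisk R by move=> z [].
have UD : B1 `|` (B2 `\` B1) `<=` pdisk R by move=> z [/B1D|[/B2D]].
(* [mu_g] is a set function defined by an integral; subadditivity over the two boxes is obtained
   from the disjoint pieces [B1] and [B2] minus [B1]. *)
apply: (@le_trans _ _ (mu_g l p g (B1 `|` (B2 `\` B1)))).
  apply: mono => //; [exact: measurable_shadow|exact: measurableU|].
  by move=> z /sub zB; have [|nB1] := pselect (B1 z); [left|case: zB => // ?; right].
rewrite /mu_g ge0_integral_setU//; last 2 first.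
- by apply: gm => //; exact: measurableU.
- by rewrite disj_set2E; apply/eqP/seteqP; split=> // z [? []].
rewrite -mulrA mulr2n mulrDl mul1r EFinD; apply: leeD; first exact: bound.
by apply: le_trans (bound _ t2p s2); apply: mono => // z [].
Qed.

End shadow.

(** * Pointwise bound and Carleson embedding *)

Section embedding.
Context {R : realType}.
Implicit Types (z w : plane R).

(** The Bergman integrand is symmetrized under conjugation, to match the right-hand side of the
    sub-mean-value inequality. *)
Definition bergman_density (p a : R) (f : R[i] -> R[i]) z : R :=
  (cabs (f (cplx z)) `^ p + cabs (f (cplx (pconj z))) `^ p) * depth z `^ (a - 1).

Lemma bergman_density_ge0 p a f z : 0 <= bergman_density p a f z.
Proof. by rewrite mulr_ge0 ?addr_ge0 ?powR_ge0. Qed.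

Lemma measurable_bergman_density (l p a : R) f : lambda_analytic l f ->
  measurable_fun (pdisk R : set (plane R)) (bergman_density p a f).
Proof.
move=> /lambda_analytic_measurable mf; apply: measurable_funM.
  by apply: measurable_funD; [exact: measurable_cabs_powR|exact: measurable_cabs_powR_pconj].
apply: (measurableT_comp (measurable_powR _)).
by apply: (@measurable_funS _ _ _ _ setT) => //; exact: measurable_depth.
Qed.

Lemma integral_bergman_density (l p a : R) f : lambda_analytic l f ->
  (\int[sigma l]_(z in pdisk R) (bergman_density p a f z)%:E =
   2%:E * \int[sigma l]_(z in pdisk R)
      (cabs (f (cplx z)) `^ p * (1 - cabs (cplx z)) `^ (a - 1))%:E)%E.
Proof.
move=> lf; have mf := lambda_analytic_measurable lf.
pose h z := (cabs (f (cplx z)) `^ p * depth z `^ (a - 1))%:E.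
have mh : measurable_fun (pdisk R : set (plane R)) h.
  apply/measurable_EFinP; apply: measurable_funM; first exact: measurable_cabs_powR.
  apply: (measurableT_comp (measurable_powR _)).
  by apply: (@measurable_funS _ _ _ _ setT) => //; exact: measurable_depth.
have h0 z : (0 <= h z)%E by rewrite lee_fin mulr_ge0 ?powR_ge0.
have dc z : depth (pconj z) = depth z.
  by case: z => x y; rewrite /depth /pconj /cplx !cabsE/= sqrrN.
have pcD : @pconj R @^-1` pdisk R = pdisk R.
  apply/seteqP; split=> -[x y] /=; last exact: pdisk_conj.
  by move=> /pdisk_conj; rewrite opprK.
have mhc : measurable_fun (pdisk R : set (plane R)) (h \o @pconj R).
  apply: (measurable_comp measurable_disk _ mh).
    by move=> _ [[x y] Dw <-]; exact: pdisk_conj.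
  by apply: (@measurable_funS _ _ _ _ setT) => //; exact: measurable_pconj.
transitivity (\int[sigma l]_(z in pdisk R) (h z + h (pconj z)))%E.
  apply: eq_integral => z _.
  by rewrite /h dc -EFinD -mulrDl.
rewrite (ge0_integralD (sigma l) measurable_disk (fun z _ => h0 z) mh (fun z _ => h0 (pconj z)) mhc).
rewrite -{2}pcD integral_pconj//; last exact: measurable_disk.
by rewrite [RHS]mule_natl mule2n.
Qed.

(** The factor [depth z ^ (a - 1)] may be moved under the integral because [depth] is nearly
    constant on a Whitney box; together with [depth z ^ 2] it forms the exponent [a + 1]. *)
Lemma lambda_pointwise (l p a : R) : 0 <= l -> 0 < p -> 0 < c_lambda l ->
  exists2 K : R, 0 < K & forall f : R[i] -> R[i], lambda_analytic l f ->
  forall z : plane R, pdisk R z ->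
  ((cabs (f (cplx z)) `^ p * weight l (a + 1) z)%:E <=
    K%:E * \int[sigma l]_(w in whitney z) (bergman_density p a f w)%:E)%E.
Proof.
move=> l0 p0 c0; have [K K0 HK] := lambda_submean l0 p0.
set M : R := 2 `^ `|a - 1|.
have M0 : 0 < M by rewrite powR_gt0.
exists (K * M / c_lambda l); first by rewrite divr_gt0//; exact: mulr_gt0.
move=> f lf z Dz; have mf := lambda_analytic_measurable lf.
have z0 := (depth_gt0 _).1 Dz.
have WD : whitney z `<=` pdisk R by move=> w; exact: whitney_pdisk.
have mW := measurable_whitney z.
have := HK f lf z Dz.
set h := (fun w : plane R => (cabs (f (cplx w)) `^ p + cabs (f (cplx (pconj w))) `^ p)%:E).
set I := (\int[_]_(_ in _) _)%E => H.
have h0 w : (0 <= h w)%E by rewrite lee_fin addr_ge0 ?powR_ge0.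
have mh : measurable_fun (whitney z) h.
  apply: (@measurable_funS _ _ _ _ (pdisk R : set (plane R))) => //; first exact: measurable_disk.
  apply/measurable_EFinP.
  by apply: measurable_funD; [exact: measurable_cabs_powR|exact: measurable_cabs_powR_pconj].
have mb : measurable_fun (whitney z) (fun w => (bergman_density p a f w)%:E).
  apply: (@measurable_funS _ _ _ _ (pdisk R : set (plane R))) => //; first exact: measurable_disk.
  by apply/measurable_EFinP; exact: measurable_bergman_density lf.
have H1 : ((depth z `^ (a - 1))%:E * I <=
    M%:E * \int[sigma l]_(w in whitney z) (bergman_density p a f w)%:E)%E.
  rewrite /I -(ge0_integralZl_EFin (sigma l) mW (fun w _ => h0 w) mh (powR_ge0 _ _)).
  rewrite -(ge0_integralZl_EFin (sigma l) mW _ mb (ltW M0)); last first.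
    by move=> w _; rewrite lee_fin bergman_density_ge0.
  apply: ge0_le_integral => //.
  - move=> w _; apply: mule_ge0; first by rewrite lee_fin powR_ge0.
    by rewrite lee_fin addr_ge0 ?powR_ge0.
  - exact: measurable_funeM.
  - exact: measurable_funeM.
  move=> w zw; have [h1 h2] := whitney_depth zw.
  rewrite -!EFinM lee_fin /bergman_density [leRHS]mulrCA [leLHS]mulrC.
  apply: ler_wpM2l; first by rewrite addr_ge0 ?powR_ge0.
  by apply: powR_ratio => //; [apply/depth_gt0; exact: WD|lra|lra].
have -> : cabs (f (cplx z)) `^ p * weight l (a + 1) z = (c_lambda l)^-1 * (depth z `^ (a - 1) *
    (c_lambda l * (cabs (f (cplx z)) `^ p * (depth z ^+ 2 * (depth z + `|z.2|) `^ (2 * l))))).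
  rewrite /weight (_ : a + 1 = (a - 1) + 2%:R); last by ring.
  rewrite powRD; last by rewrite (gt_eqF z0) implybT.
  by rewrite powR_mulrn ?(ltW z0)//; field; rewrite gt_eqF.
have -> : K * M / c_lambda l = (c_lambda l)^-1 * (K * M) by rewrite mulrC.
rewrite [X in (X <= _)%E]EFinM [X in (_ <= X * _)%E]EFinM -muleA.
apply: lee_wpmul2l; first by rewrite lee_fin invr_ge0 ltW.
rewrite [X in (X <= _)%E]EFinM [X in (_ <= X * _)%E]EFinM -muleA.
apply: (@le_trans _ _ ((depth z `^ (a - 1))%:E * (K%:E * I))%E).
  by apply: lee_wpmul2l; [rewrite lee_fin powR_ge0|exact: H].
rewrite [X in (X <= _)%E]muleCA; apply: lee_wpmul2l; first by rewrite lee_fin ltW.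
exact: H1.
Qed.

(** After the exchange, the inner integral runs over the shadow of [w], where
    [1 / wq z <= T / wq w]. The shadow bound [C * wq w] cancels this denominator and leaves
    [T * C * h w]. *)
Lemma whitney_tonelli (l T C : R) (gp h wq : plane R -> R) : 0 <= l -> 0 < T ->
  measurable_fun (pdisk R : set (plane R)) gp ->
  measurable_fun (pdisk R : set (plane R)) h ->
  measurable_fun (pdisk R : set (plane R)) (fun z => (wq z)^-1) ->
  (forall z, 0 <= gp z) -> (forall z, 0 <= h z) -> (forall z, pdisk R z -> 0 < wq z) ->
  (forall z w, pdisk R z -> whitney z w -> wq w <= T * wq z) ->
  (forall w, pdisk R w -> (\int[sigma l]_(z in shadow w) (gp z)%:E <= (C * wq w)%:E)%E) ->
  let J z := ((gp z / wq z)%:E * \int[sigma l]_(w in whitney z) (h w)%:E)%E in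
  measurable_fun (pdisk R : set (plane R)) J /\
  (\int[sigma l]_(z in pdisk R) J z <=
    (T * C)%:E * \int[sigma l]_(w in pdisk R) (h w)%:E)%E.
Proof.
move=> l0 T0 mgp mh mwq gp0 h0 wq0 wqT HS J.
have mD := @measurable_disk R.
have iwq0 z : pdisk R z -> 0 <= gp z / wq z.
  by move=> /wq0 /ltW; exact: divr_ge0.
(* The functions are measurable on the disk only; restricting to [E] gives a measurable function on
   the whole product. *)
pose E : set (plane R * plane R) := (pdisk R `*` pdisk R) `&` (whitneyb @^-1` [set true]).
have mE : measurable E.
  apply: measurableI; first exact: measurableX.
  by rewrite -[X in measurable X]setTI; exact: measurable_whitneyb.
have inE' z w : ((z, w) \in E) = (z \in shadow w) && (w \in pdisk R).
  apply/idP/andP; rewrite !inE.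
    by move=> [[Dz Dw] /whitneyP zw]; split=> //; exact: (conj Dz zw).
  by move=> [[Dz zw] Dw]; exact: (conj (conj Dz Dw) (introT (whitneyP z w) zw)).
pose F := (fun u : plane R * plane R => (gp u.1 / wq u.1 * h u.2)%:E) \_ E.
have mF : measurable_fun setT F.
  apply/(measurable_restrictT _ mE)/measurable_EFinP.
  have mfst (k : plane R -> R) : measurable_fun (pdisk R : set (plane R)) k ->
      measurable_fun E (fun u => k u.1).
    move=> mk; apply: (measurable_comp mD _ mk); first by move=> _ [u [[? ?] ?] <-].
    by apply: (measurable_funS measurableT (@subsetT _ _)); exact: measurable_fst.
  have msnd (k : plane R -> R) : measurable_fun (pdisk R : set (plane R)) k ->
      measurable_fun E (fun u => k u.2).
    move=> mk; apply: (measurable_comp mD _ mk); first by move=> _ [u [[? ?] ?] <-].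
    by apply: (measurable_funS measurableT (@subsetT _ _)); exact: measurable_snd.
  apply: measurable_funM; last exact: (msnd _ mh).
  by apply: measurable_funM; [exact: (mfst _ mgp)|exact: (mfst _ mwq)].
have F0 u : (0 <= F u)%E.
  apply: erestrict_ge0 => -[z w] [[/= Dz _] _].
  by rewrite lee_fin; apply: mulr_ge0 => //; exact: iwq0.
have [swap mFz mFw] := sigma_tonelli l0 mF F0.
have WD z : pdisk R z -> whitney z `<=` pdisk R by move=> Dz w; exact: whitney_pdisk.
have mhE (A : set (plane R)) : A `<=` pdisk R -> measurable_fun A (fun w => (h w)%:E).
  by move=> AD; apply: (measurable_funS mD AD); exact/measurable_EFinP.
have h0E (A : set (plane R)) w : A w -> (0 <= (h w)%:E)%E by rewrite lee_fin.
have FzE z : pdisk R z -> (\int[sigma l]_w F (z, w) = J z)%E.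
  move=> Dz; rewrite /J -(ge0_integralZl_EFin (sigma l) (measurable_whitney z)
    (@h0E (whitney z)) (mhE _ (WD z Dz)) (iwq0 z Dz)).
  rewrite integral_mkcond; apply: eq_integral => w _.
  rewrite /F !patchE inE'.
  have -> : (z \in shadow w) && (w \in pdisk R) = (w \in whitney z).
    apply/andP/idP; rewrite !inE; first by move=> [[]].
    by move=> zw; split; [exact: (conj Dz zw)|exact: (WD z Dz)].
  by case: ifPn => // _; rewrite -EFinM.
have Fw w : pdisk R w -> (\int[sigma l]_z F (z, w) <= (T * C)%:E * (h w)%:E)%E.
  move=> Dw.
  have ms := measurable_shadow w.
  have sD : shadow w `<=` pdisk R by move=> z [].
  have mgps : measurable_fun (shadow w) (fun z => (gp z)%:E).
    by apply: (measurable_funS mD sD); exact/measurable_EFinP.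
  have wqw := wq0 _ Dw.
  have k0 : 0 <= T / wq w * h w by apply: mulr_ge0 => //; apply: divr_ge0; exact: ltW.
  apply: (@le_trans _ _ (\int[sigma l]_(z in shadow w) ((T / wq w * h w)%:E * (gp z)%:E))%E).
    rewrite [leRHS]integral_mkcond; apply: ge0_le_integral => //.
    - by apply: (measurableT_comp mF); exact: measurable_pair2.
    - apply/(measurable_restrictT _ ms); exact: measurable_funeM.
    move=> z _; rewrite /F !patchE inE' [w \in _]mem_set// andbT.
    case: ifPn => // /set_mem [Dz zw]; rewrite -EFinM lee_fin.
    have -> : T / wq w * h w * gp z = gp z * (T / wq w) * h w by ring.
    apply: ler_wpM2r => //; apply: ler_wpM2l => //.
    rewrite ler_pdivlMr// mulrC ler_pdivrMr; last exact: wq0.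
    exact: wqT.
  rewrite ge0_integralZl_EFin//; last by move=> z _; rewrite lee_fin.
  apply: (@le_trans _ _ ((T / wq w * h w)%:E * (C * wq w)%:E)%E).
    by apply: lee_wpmul2l; [rewrite lee_fin|exact: HS].
  rewrite -!EFinM lee_fin le_eqVlt; apply/orP; left; apply/eqP.
  by field; rewrite gt_eqF.
have FwN w : ~ pdisk R w -> (\int[sigma l]_z F (z, w) = 0)%E.
  move=> nDw; rewrite -[RHS](integral0 (sigma l) setT); apply: eq_integral => z _.
  by rewrite /F patchE inE' [w \in _]memNset// andbF.
have mFzD : measurable_fun (pdisk R : set (plane R)) (fun z => \int[sigma l]_w F (z, w))%E.
  exact: (measurable_funS measurableT (@subsetT _ _) mFz).
split.
  by apply: eq_measurable_fun mFzD => z /set_mem; exact: FzE.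
rewrite (eq_integral (fun z => \int[sigma l]_w F (z, w))%E); last first.
  by move=> z /set_mem /FzE.
have TC0 w : pdisk R w -> 0 <= T * C.
  move=> Dw; apply: mulr_ge0; first exact: ltW.
  have := HS w Dw; have : (0 <= \int[sigma l]_(z in shadow w) (gp z)%:E)%E.
    by apply: integral_ge0 => z _; rewrite lee_fin.
  by move=> /le_trans h1 /h1; rewrite lee_fin pmulr_lge0// wq0.
(* The disk is nonempty, and the shadow bound at one of its points forces [0 <= T * C]. *)
have D0 : pdisk R (0, 0) by apply/pdiskE; rewrite expr0n addr0 ltr01.
apply: (@le_trans _ _ (\int[sigma l]_z \int[sigma l]_w F (z, w))%E).
  apply: ge0_subset_integral => //.
  by move=> z _; exact: integral_ge0.
rewrite swap -(ge0_integralZl_EFin (sigma l) mD (@h0E _) (mhE _ (@subset_refl _ _)) (TC0 _ D0)).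
rewrite [leRHS]integral_mkcond; apply: ge0_le_integral => //.
- by move=> w _; exact: integral_ge0.
- by apply/(measurable_restrictT _ mD); apply: measurable_funeM; exact: mhE.
move=> w _; rewrite patchE; case: ifPn => [/set_mem|/negP nD]; first exact: Fw.
by rewrite FwN// => Dw; apply: nD; rewrite inE.
Qed.

(** For [q = p2 / p1 >= 1] the power is linearized by [j ^ q <= j * b ^ (q - 1)], where [b] bounds
    every local integral [j]; the linear factor can then be integrated by Tonelli. *)
Lemma pointwise_power (p1 p2 K1 W G f j b : R) : 0 < p1 -> p1 <= p2 -> 0 < K1 ->
  0 < W -> 0 <= G -> 0 <= f -> 0 <= j -> j <= b -> f `^ p1 * W <= K1 * j ->
  G * f `^ p2 <= K1 `^ (p2 / p1) * b `^ (p2 / p1 - 1) * (G / W `^ (p2 / p1) * j).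
Proof.
move=> p10 p12 K10 W0 G0 f0 j0 jb fle; set q := p2 / p1.
have q1 : 1 <= q by rewrite ler_pdivlMr// mul1r.
have qp : 0 < q by exact: lt_le_trans q1.
have -> : f `^ p2 = (f `^ p1) `^ q by rewrite -powRrM mulrC /q divfK// gt_eqF.
rewrite -ler_pdivlMr// in fle.
have {}fle : (f `^ p1) `^ q <= K1 `^ q * (j `^ q) / W `^ q.
  apply: (@le_trans _ _ ((K1 * j / W) `^ q)).
    apply: ge0_ler_powR => //; first exact: ltW.
      by rewrite nnegrE powR_ge0.
    by rewrite nnegrE; apply: divr_ge0; [apply: mulr_ge0 => //|]; exact: ltW.
  rewrite powRM; last 2 first.
  - by apply: mulr_ge0 => //; exact: ltW.
  - by rewrite invr_ge0 ltW.
  rewrite powRM//; last exact: ltW.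
  by rewrite -powR_inv1 ?(ltW W0)// -powRrM mulN1r powRN.
have jq : j `^ q <= j * b `^ (q - 1).
  rewrite -(mulr_powRB1 j0 qp); apply: ler_wpM2l => //.
  by apply: ge0_ler_powR; rewrite ?subr_ge0 ?nnegrE// (le_trans j0).
have -> : K1 `^ q * b `^ (q - 1) * (G / W `^ q * j) = G * (K1 `^ q * (j * b `^ (q - 1)) / W `^ q).
  by ring.
apply: ler_wpM2l => //; apply: (le_trans fle); apply: ler_wpM2r.
  by rewrite invr_ge0 powR_ge0.
by apply: ler_wpM2l => //; exact: powR_ge0.
Qed.

Lemma carleson_embedding (l a p1 p2 C : R) (g : R[i] -> R[i]) :
  0 <= l -> 0 < p1 -> p1 <= p2 -> 0 < a -> 0 < c_lambda l -> lambda_analytic l g ->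
  (forall t h : R, 0 <= t < 2 * pi -> 0 < h < 1 ->
    (mu_g l p2 g (carleson_box t h) <=
      (C * ((h + `|sin t|) `^ (2 * (l * (p2 / p1))) * h `^ ((a + 1) * (p2 / p1))))%:E)%E) ->
  exists2 K : R, 0 <= K & forall f : R[i] -> R[i], lambda_analytic l f -> forall b : R,
  (\int[sigma l]_(z in pdisk R) (bergman_density p1 a f z)%:E)%E = b%:E ->
  (\int[sigma l]_(z in pdisk R)
     (cabs (g (cplx z)) `^ p2 * cabs (f (cplx z)) `^ p2)%:E <= (K * b `^ (p2 / p1))%:E)%E.
Proof.
move=> l0 p10 p12 a0 c0 lg HC.
set q := p2 / p1; have q1 : 1 <= q by rewrite ler_pdivlMr// mul1r.
have q0 : 0 <= q by exact: le_trans q1.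
have [K1 K10 HK1] := lambda_pointwise a l0 p10 c0.
have a10 : 0 <= a + 1 by rewrite addr_ge0// ltW.
have HS := mu_g_shadow l0 q0 a10 lg HC.
set C3 := 2 * (`|C| * 4 `^ (2 * (l * q))) in HS.
have C30 : 0 <= C3 by apply: mulr_ge0 => //; apply: mulr_ge0 => //; exact: powR_ge0.
set T : R := (2 `^ (a + 1 + 2 * l)) `^ q.
have T0 : 0 < T by rewrite powR_gt0// powR_gt0.
exists (K1 `^ q * (T * C3)).
  by apply: mulr_ge0; [exact: powR_ge0|apply: mulr_ge0 => //; exact: ltW].
move=> f lf b bE.
have mf := lambda_analytic_measurable lf.
have mg := lambda_analytic_measurable lg.
have mD := @measurable_disk R.
have W0 z := @weight_gt0 _ l (a + 1) z.
have mwq : measurable_fun (pdisk R : set (plane R)) (fun z => (weight l (a + 1) z `^ q)^-1).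
  rewrite (_ : (fun z => _) = (fun z => weight l (a + 1) z `^ (- q))); last first.
    by apply/funext => z; rewrite powRN.
  apply: (measurableT_comp (measurable_powR _)).
  exact: (measurable_funS measurableT (@subsetT _ _) (measurable_weight _ _)).
have wqT z w : pdisk R z -> whitney z w ->
    weight l (a + 1) w `^ q <= T * weight l (a + 1) z `^ q.
  move=> Dz zw; have Ww := W0 _ (whitney_pdisk Dz zw); have Wz := W0 _ Dz.
  rewrite /T -powRM ?powR_ge0 ?(ltW Wz)//; apply: ge0_ler_powR => //.
  - by rewrite nnegrE ltW.
  - by rewrite nnegrE; apply: mulr_ge0; [exact: powR_ge0|exact: ltW].
  - exact: weight_whitney.
have [mJ IJ] := whitney_tonelli l0 T0 (measurable_cabs_powR p2 mg)
  (measurable_bergman_density p1 a lf) mwq (fun z => powR_ge0 _ _)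
  (bergman_density_ge0 p1 a f) (fun z Dz => powR_gt0 q (W0 z Dz)) wqT HS.
rewrite bE in IJ.
have b0 : 0 <= b.
  by rewrite -lee_fin -bE; apply: integral_ge0 => w _; rewrite lee_fin bergman_density_ge0.
have Kb0 : 0 <= K1 `^ q * b `^ (q - 1) by apply: mulr_ge0; exact: powR_ge0.
(* The linear estimate contributes [b], and the linearization [b ^ (q - 1)]; together they give
   [b ^ q]. *)
apply: (@le_trans _ _ ((K1 `^ q * b `^ (q - 1))%:E * ((T * C3)%:E * b%:E))%E); last first.
  rewrite -!EFinM lee_fin le_eqVlt; apply/orP; left; apply/eqP.
  by rewrite -(mulr_powRB1 b0 (lt_le_trans ltr01 q1)); ring.
have J0 z : (0 <= \int[sigma l]_(w in whitney z) (bergman_density p1 a f w)%:E)%E.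
  by apply: integral_ge0 => w _; rewrite lee_fin bergman_density_ge0.
apply: le_trans (lee_wpmul2l _ IJ); last by rewrite lee_fin.
have J'0 z : pdisk R z -> (0 <= (cabs (g (cplx z)) `^ p2 / weight l (a + 1) z `^ q)%:E *
    \int[sigma l]_(w in whitney z) (bergman_density p1 a f w)%:E)%E.
  by move=> Dz; apply: mule_ge0 => //; rewrite lee_fin; apply: divr_ge0; exact: powR_ge0.
rewrite -(ge0_integralZl_EFin (sigma l) mD J'0 mJ Kb0).
have mI := measurable_funeM (K1 `^ q * b `^ (q - 1))%:E mJ.
apply: ge0_le_integral => //.
- by move=> z _; rewrite lee_fin; apply: mulr_ge0; exact: powR_ge0.
- by apply/measurable_EFinP; apply: measurable_funM; exact: measurable_cabs_powR.
move=> z Dz.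
have : (\int[sigma l]_(w in whitney z) (bergman_density p1 a f w)%:E <= b%:E)%E.
  rewrite -bE; apply: ge0_subset_integral => //.
  - exact: measurable_whitney.
  - by apply/measurable_EFinP; exact: measurable_bergman_density lf.
  - by move=> w _; rewrite lee_fin bergman_density_ge0.
  - by move=> w; exact: whitney_pdisk.
have := HK1 f lf z Dz; have := J0 z.
(* The bound by the finite total [b] excludes an infinite local integral. *)
case: (\int[sigma l]_(w in whitney z) _)%E => [j| |] //.
rewrite -!EFinM !lee_fin => j0 H jb.
have Wz := W0 _ Dz.
exact: (pointwise_power p10 p12 K10 Wz (powR_ge0 _ _) (cabs_ge0 _) j0 jb H).
Qed.

End embedding.

(** * Norms and the multiplication operator *)

Section norms.
Context {R : realType}.

Lemma measurable_mult_op (g f : R[i] -> R[i]) : disk_measurable_fun g ->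
  disk_measurable_fun f -> disk_measurable_fun (mult_op g f).
Proof.
move=> [g1 g2] [f1 f2]; split.
  rewrite (_ : re_part _ = (fun z => re_part g z * re_part f z - im_part g z * im_part f z)).
    by apply: measurable_funB; apply: measurable_funM.
  by apply/funext => z; rewrite /re_part /im_part /mult_op; case: (g _) => ? ?; case: (f _).
rewrite (_ : im_part _ = (fun z => re_part g z * im_part f z + im_part g z * re_part f z)).
  by apply: measurable_funD; apply: measurable_funM.
by apply/funext => z; rewrite /re_part /im_part /mult_op; case: (g _) => ? ?; case: (f _).
Qed.

Lemma cabsM (a b : R[i]) : cabs (a * b) = cabs a * cabs b.
Proof.
have cE (c : R[i]) : (cabs c)%:C%C = `|c| by rewrite /cabs normc_def.
by apply: (@complexI R); rewrite rmorphM/= !cE normrM.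
Qed.

Lemma integral_sigma0 (l : R) (D : set (plane R)) (h : plane R -> \bar R) :
  c_lambda l = 0 -> (\int[sigma l]_(z in D) h z = 0)%E.
Proof.
move=> c0; rewrite -[RHS](integral_measure_zero D h); apply: eq_measure_integral => A mA _.
rewrite /mzero -[RHS](integral0 (@lebesgue_measure R \x @lebesgue_measure R)%E A).
by apply: eq_integral => z _; rewrite /sigma_density c0 mul0r.
Qed.

End norms.

Local Open Scope complex_scope.

Theorem theorem8p6 (R : realType) (lambda p1 p2 alpha : R) (g : R[i] -> R[i])
    (hlambda : 0 <= lambda)
    (hp1 : 0 < p1)
    (hp0p1 : 2 * lambda / (2 * lambda + 1) <= p1)
    (hp1le1 : p1 <= 1)
    (hp2 : 1 <= p2)
    (halpha : 0 < alpha)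
    (hg : lambda_analytic lambda g)
    (hmu : carleson_measure (lambda * p2 / p1) ((alpha + 1) * p2 / p1)
             (mu_g lambda p2 g)) :
  mult_op_bounded lambda alpha p1 p2 g.
Proof.
have p20 : 0 < p2 by exact: lt_le_trans hp2.
have mg := lambda_analytic_measurable hg.
(* The Gamma integrals are known here only to be nonnegative. If the normalizing constant were zero,
   [sigma] would be the zero measure and every target norm would vanish, so the constant 0 works. *)
have [c0|c0] : c_lambda lambda = 0 \/ 0 < c_lambda lambda.
  by have := c_lambda_ge0 lambda; rewrite le_eqVlt => /predU1P[<-|]; [left|right].
  exists 0 => f [lf _]; have mgf := measurable_mult_op mg (lambda_analytic_measurable lf).
  have L0 : Lp_norm lambda p2 (mult_op g f) = 0%E.
    by rewrite /Lp_norm integral_sigma0// poweR0r// invr_eq0 gt_eqF.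
  by split; [split => //; rewrite L0|rewrite L0 mul0e].
have [_ [C HC]] := hmu.
have HC' (t h : R) : 0 <= t < 2 * pi -> 0 < h < 1 ->
    (mu_g lambda p2 g (carleson_box t h) <=
     (C * ((h + `|sin t|) `^ (2 * (lambda * (p2 / p1))) * h `^ ((alpha + 1) * (p2 / p1))))%:E)%E.
  by move=> tp h1; rewrite (mulrA lambda) (mulrA (alpha + 1)); exact: HC.
have [K K0 HK] := carleson_embedding hlambda hp1 (le_trans hp1le1 hp2) halpha c0 hg HC'.
set q := p2 / p1 in HK.
(* The factor [2 ^ q] accounts for the symmetrized density, whose integral is twice the Bergman
   integral [b]; the root [p2^-1] then turns [b ^ q] into [b ^ (1 / p1)]. *)
exists ((K * 2 `^ q) `^ p2^-1) => f [lf ff].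
have mf := lambda_analytic_measurable lf.
move: ff; rewrite /bergman_norm; set B := (\int[_]_(_ in _) _)%E => ff.
have B0 : (0 <= B)%E by apply: integral_ge0 => z _; rewrite lee_fin; apply: mulr_ge0; exact: powR_ge0.
have Bfin : (B < +oo)%E by apply: lty_poweRy ff; rewrite invr_eq0 gt_eqF.
have [b bE] : exists b : R, B = b%:E.
  by exists (fine B); rewrite fineK// ge0_fin_numE.
have b0 : 0 <= b by rewrite -lee_fin -bE.
have := HK f lf (2 * b); rewrite integral_bergman_density// -/B bE -EFinM => /(_ erefl).
have IE : (\int[sigma lambda]_(z in pdisk R) (cabs (g (cplx z)) `^ p2 * cabs (f (cplx z)) `^ p2)%:E =
    \int[sigma lambda]_(z in pdisk R) (cabs (mult_op g f (cplx z)) `^ p2)%:E)%E.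
  by apply: eq_integral => z _; rewrite /mult_op cabsM powRM ?cabs_ge0.
rewrite IE => HI.
have bound : (Lp_norm lambda p2 (mult_op g f) <= ((K * 2 `^ q) `^ p2^-1)%:E * b%:E `^ p1^-1)%E.
  rewrite /Lp_norm poweR_EFin -EFinM.
  rewrite (_ : (K * 2 `^ q) `^ p2^-1 * b `^ p1^-1 = (K * (2 * b) `^ q) `^ p2^-1); last first.
    rewrite (powRM (x := 2))// mulrA (powRM (x := K * 2 `^ q)) ?powR_ge0//.
      by rewrite -powRrM /q mulrAC divff ?gt_eqF// mul1r.
    by apply: mulr_ge0 => //; exact: powR_ge0.
  rewrite -poweR_EFin; apply: gt0_ler_poweR => //.
  - by rewrite invr_ge0 ltW.
  - rewrite in_itv/= leey andbT; apply: integral_ge0 => z _; rewrite lee_fin; exact: powR_ge0.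
  - rewrite in_itv/= leey andbT lee_fin; apply: mulr_ge0 => //; exact: powR_ge0.
split=> //; split; first exact: measurable_mult_op.
by apply: (le_lt_trans bound); rewrite poweR_EFin -EFinM ltry.
Qed.
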